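(* For $f\in B^+_{\infty,0}$, $f(z)=\int_0^\infty e^{-\xi z}d\mu(\xi)$, let $\mathfrak m(f)$ be the function $\mathfrak m(f)(\xi)=\mu([0,\xi])$, $\xi\ge0$. (i) The map $B^+_{\infty,0}\ni f\mapsto\mathfrak m(f)$ defines an isomorphism of $B^+_{\infty,0}$ with a sub-ring of the Mikusinski ring $\mathcal M(\mathbb R_+)$. (ii) There exists a unique function $\iota\in B^+_{\infty,0}$ such that $\mathfrak m(\iota)=I$, where $I(\xi)=\xi$, and one has $\iota(z)=\frac1z$ for all $z>0$. (iii) The isomorphism $\mathfrak m$ of (i) extends uniquely to an injective homomorphism of the Fréchet algebra $B^+_\infty$ into the Mikusinski field $\mathfrak M$.
   Context: $B^+_\infty$ is the Fréchet algebra of functions $f(z)=\int_0^\infty e^{-\xi z}d\mu(\xi)$, $z>0$, where $\mu$ is a real Radon measure on $[0,\infty)$ with $\int_0^\infty e^{-\alpha\xi}|d\mu(\xi)|<\infty$ for all $\alpha>0$; operations are pointwise (equivalently, convolution of measures) and the topology is given by the norms $\|f\|_\rho=\int_0^\infty e^{\xi/\log\rho}|d\mu(\xi)|$, $\rho\in(0,1)$. $B^+_{\infty,0}=J+\mathbb R\subset B^+_\infty$ is the sub-ring obtained by adjoining the unit to the ideal $J$ of those $f$ whose measure $\mu$ is absolutely continuous with respect to Lebesgue measure. The Mikusinski ring $\mathcal M(\mathbb R_+)$ consists of the functions on $\mathbb R_+=[0,\infty)$ with locally integrable derivative (i.e. absolutely continuous on compact intervals), with pointwise addition and the Duhamel product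 $F\star G(t)=\frac{d}{dt}\int_0^tF(u)G(t-u)\,du$. It is an integral domain (Titchmarsh), and $\mathfrak M$ denotes its field of fractions. *)

(* Defs.v *)
From HB Require Import structures.
From mathcomp Require Import all_boot all_order all_algebra.
From mathcomp Require Import all_classical all_reals all_analysis.

Set Implicit Arguments.
Unset Strict Implicit.
Unset Printing Implicit Defensive.

Import Order.TTheory GRing.Theory Num.Theory.
Import numFieldNormedType.Exports.

Local Open Scope classical_set_scope.
Local Open Scope ring_scope.

(* Sub-rings, and ring homomorphisms defined on them, relative to explicitly
   given products and units: the functions on [0, +oo[ carry the Duhamel product
   and not the library's pointwise one. *)
Section SubsetRings.
Variables (T U : zmodType).

Record subring_on (mul : T -> T -> T) (one : T) (A : set T) : Prop := {
  subring_on1 : A one;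
  subring_onB : forall a b, A a -> A b -> A (a - b);
  subring_onM : forall a b, A a -> A b -> A (mul a b) }.

Record ring_hom_on (A : set T) (mulT : T -> T -> T) (oneT : T)
    (mulU : U -> U -> U) (oneU : U) (phi : T -> U) : Prop := {
  ring_hom_on1 : phi oneT = oneU;
  ring_hom_onD : forall a b, A a -> A b -> phi (a + b) = phi a + phi b;
  ring_hom_onM : forall a b, A a -> A b -> phi (mulT a b) = mulU (phi a) (phi b) }.

Definition injective_on (A : set T) (phi : T -> U) : Prop :=
  forall a b, A a -> A b -> phi a = phi b -> a = b.

End SubsetRings.

Section RadonMeasures.
Variable R : realType.

(* A real Radon measure on [0, +oo[, given by its Jordan decomposition
   mpos - mneg.  Each part is a Borel measure on the line, finite on compact
   sets (hence regular) and carried by [0, +oo[.  Neither part has to be finite,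
   so the difference is only defined on bounded Borel sets. *)
Record real_radon := RealRadon {
  mpos : {measure set (measurableTypeR R) -> \bar R};
  mneg : {measure set (measurableTypeR R) -> \bar R};
  mpos_carried : mpos (`]-oo, 0[%classic : set R) = 0%E;
  mneg_carried : mneg (`]-oo, 0[%classic : set R) = 0%E;
  mpos_compact : forall K : set R, compact K -> (mpos K < +oo)%E;
  mneg_compact : forall K : set R, compact K -> (mneg K < +oo)%E;
  mpos_mneg_singular : exists P : set (measurableTypeR R),
    [/\ measurable P, mpos (~` P) = 0%E & mneg P = 0%E] }.

(* The parts being mutually singular, their sum is the variation |mu|. *)
Definition tvar (mu : real_radon) : {measure set (measurableTypeR R) -> \bar R} :=
  measure_add (mpos mu) (mneg mu).

Definition radon_val (mu : real_radon) (A : set R) : R :=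
  fine (mpos mu A) - fine (mneg mu A).

Definition exp_moments (mu : real_radon) : Prop :=
  forall alpha : R, 0 < alpha ->
    (\int[tvar mu]_(xi in `[0%R, +oo[) (expR (- (alpha * xi)))%:E < +oo)%E.

Definition laplace (mu : real_radon) (z : {posnum R}) : R :=
  \int[mpos mu]_(xi in `[0, +oo[) expR (- (xi * z%:num)) -
  \int[mneg mu]_(xi in `[0, +oo[) expR (- (xi * z%:num)).

(* mu is the measure of f, as in the definition of B^+_oo. *)
Definition represents (mu : real_radon) (f : {posnum R} -> R) : Prop :=
  exp_moments mu /\ f = laplace mu.

(* B^+_oo, as a subset of the ring of functions on ]0, +oo[ with pointwise
   operations. *)
Definition Binf : set ({posnum R} -> R) :=
  [set f | exists mu, represents mu f].

Definition Jideal : set ({posnum R} -> R) :=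
  [set f | exists mu, represents mu f /\ tvar mu `<< @lebesgue_measure R].

(* B^+_{oo,0} = J + R *)
Definition Binf0 : set ({posnum R} -> R) :=
  [set f | exists g c, Jideal g /\ f = g + cst c].

Definition cumul (mu : real_radon) (xi : {nonneg R}) : R :=
  radon_val mu `[0, xi%:num].

(* f determines its measure, so that a single function is picked here; it is 0
   outside of Binf. *)
Definition mik (f : {posnum R} -> R) : {nonneg R} -> R :=
  xget 0 [set F | exists mu, represents mu f /\ F = cumul mu].

End RadonMeasures.

Section Mikusinski.
Variable R : realType.
Implicit Types F G : {nonneg R} -> R.

(* The underlying set of M(R_+): the functions with a locally integrable
   derivative g, i.e. the indefinite Lebesgue integrals. *)
Definition Mik : set ({nonneg R} -> R) :=
  [set F | exists g : R -> R,
    (forall b : R, (@lebesgue_measure R).-integrable `[0, b] (EFin \o g)) /\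
    forall t : {nonneg R},
      F t = F 0%:nng + \int[@lebesgue_measure R]_(u in `[0, t%:num]) g u].

(* F on [0, +oo[; the values on the negative reals are irrelevant. *)
Definition ext0 F (t : R) : R := F `|t|%:nng.

Definition conv F G (t : R) : R :=
  \int[@lebesgue_measure R]_(u in `[0, t]) (ext0 F u * ext0 G (t - u)).

(* d/dt is the derivative on the domain [0, +oo[: it is one-sided at 0. *)
Definition duhamel F G : {nonneg R} -> R := fun t =>
  lim ((conv F G s - conv F G t%:num) / (s - t%:num)
         @[s --> within [set s | 0 <= s] (t%:num)^']).

(* j : M(R_+) -> K makes the field K the field of fractions of M(R_+); the
   values of j outside of Mik are irrelevant. *)
Record Mik_fraction_field (K : fieldType) (j : ({nonneg R} -> R) -> K) : Prop := {
  Mik_frac_hom : ring_hom_on Mik duhamel (cst 1) *%R 1 j;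
  Mik_frac_inj : injective_on Mik j;
  Mik_frac_surj : forall k : K, exists F G,
    [/\ Mik F, Mik G, G <> 0 & k = j F / j G] }.

End Mikusinski.

(* Main.v *)
Require Import Defs.
From HB Require Import structures.
From mathcomp Require Import all_boot all_order all_algebra.
From mathcomp Require Import all_classical all_reals all_analysis.
From mathcomp Require Import measurable_realfun ring lra.

Set Implicit Arguments.
Unset Strict Implicit.
Unset Printing Implicit Defensive.

Import Order.TTheory GRing.Theory Num.Theory.
Import numFieldNormedType.Exports.

Local Open Scope classical_set_scope.
Local Open Scope ring_scope.

(** Why the theorem is true.  An element f of B^+_oo is the Laplace transform of
its measure mu, and pointwise products of transforms come from convolutions of
measures.  The function iota(z) = 1/z is the transform of Lebesgue measure on
[0, +oo[, so multiplying by iota amounts to taking the cumulative function: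
f(z)/z is the transform of the measure with density x |-> mu([0, x])
(cumul_has_density).  In particular f iota lies in J for every f in B^+_oo, and
mu([0, .]) determines f (mik_inj).

The converse, that f determines mu([0, .]), is what makes m well defined; it
comes from an explicit inversion formula: mu([0, x]) is the limit of the
integrals of certain polynomials without constant term in exp(-b xi), and these
integrals are linear combinations of values of f (laplace_measure_inj).

The elements of B^+_oo,0 are the transforms of measures with a density q on
[0, +oo[ and an atom c at 0 (Binf0P).  From a measure to a density one uses
Radon-Nikodym; from q and c to a Radon measure one takes for its Jordan
decomposition the positive and negative parts of q and c (radon_of_density).
Hence m(f) = c + int_0^x q is absolutely continuous.

Convolving a measure with a density gives a density; the proof is Fubini, tested
against a function phi (convolution_density).  With an exponential
for phi, it says that J is an ideal of B^+_oo.  With the indicator of [0, x] for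
phi, applied to the measure of g and to the density F = m(f) of f iota, it says
that the measure of g f iota gives [0, x] the mass int_0^x F(u) G(x - u) du,
where G = m(g).  But g f iota also has the density m(f g), so this integral is a
primitive of the continuous function m(f g).  Its derivative, the Duhamel
product of F and G, is therefore m(f g) at every point (mikM).

Finally any extension of m to B^+_oo must send f to m(f iota) / m(iota), and
this formula does define a ring homomorphism: multiplicativity is the identity
((f g) iota) iota = (f iota) (g iota) in B^+_oo,0 (mik_extension_hom). *)

(** * Measures given by a density, and translations *)

Section DensityMeasure.
Context d (T : measurableType d) (R : realType).
Variables (m : {measure set T -> \bar R}) (h : T -> R).
Hypotheses (mh : measurable_fun setT h) (h0 : forall x, 0 <= h x).

(** The two proofs are arguments so that the measure structure declared below can
be inferred from the term alone. *)
Definition density_measure of measurable_fun setT h & (forall x, 0 <= h x) :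
  set T -> \bar R := fun A => (\int[m]_(x in A) (h x)%:E)%E.

Local Notation mu := (density_measure mh h0).

Let mu0 : mu set0 = 0%E. Proof. exact: integral_set0. Qed.

Let mu_ge0 A : (0 <= mu A)%E.
Proof. by apply: integral_ge0 => x _; rewrite lee_fin. Qed.

Let mu_sigma_additive : semi_sigma_additive mu.
Proof.
apply: semi_sigma_additive_nng_induced; first exact/measurable_EFinP.
by move=> x; rewrite lee_fin.
Qed.

HB.instance Definition _ := isMeasure.Build _ _ _ mu
  mu0 mu_ge0 mu_sigma_additive.

Import HBNNSimple.

(** True by definition for indicators, hence for simple functions, and then for
nonnegative functions by monotone convergence. *)
Lemma integral_density (D : set T) (f : T -> \bar R) :
  measurable D -> measurable_fun D f -> (forall x, D x -> 0 <= f x)%E ->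
  (\int[mu]_(x in D) f x = \int[m]_(x in D) (f x * (h x)%:E))%E.
Proof.
move=> mD mf f0; pose g := nnsfun_approx mD mf.
have mhD : measurable_fun D (EFin \o h).
  exact/measurable_EFinP/measurable_funTS.
have mgD n : measurable_fun D (EFin \o g n).
  by apply/measurable_EFinP/measurable_funTS/measurable_funP.
transitivity (limn (fun n => \int[mu]_(x in D) (EFin \o g n) x))%E.
  rewrite -monotone_convergence//.
  - apply: eq_integral => x /[!inE] Dx; apply/esym/cvg_lim => //.
    exact: cvg_nnsfun_approx.
  - by move=> n x _; rewrite lee_fin.
  - by move=> x _ a b ab; rewrite lee_fin; exact/lefP/nd_nnsfun_approx.
transitivity (limn (fun n =>
    \int[m]_(x in D) ((EFin \o g n) \* (EFin \o h)) x))%E; last first.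
  rewrite -monotone_convergence//.
  - apply: eq_integral => x /[!inE] Dx; apply/cvg_lim => //.
    by apply: cvgeZr => //; exact: cvg_nnsfun_approx.
  - by move=> n; exact: emeasurable_funM.
  - by move=> n x _; rewrite mule_ge0// lee_fin.
  - move=> x _ a b ab; rewrite lee_wpmul2r// lee_fin//.
    exact/lefP/nd_nnsfun_approx.
congr (limn _); apply/funext => n.
have indich r : measurable_fun D (fun x => (r * \1_(g n @^-1` [set r]) x)%:E).
  by apply: (measurable_comp measurableT) => //; exact: measurable_funM.
transitivity (\int[mu]_(x in D)
   (\sum_(y \in range (g n)) (y * \1_(g n @^-1` [set y]) x)%:E))%E.
  by apply: eq_integral => t tE; rewrite /= fimfunE -fsumEFin.
rewrite ge0_integral_fsum//; last by move=> y x _; exact: nnfun_muleindic_ge0.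
transitivity (\int[m]_(x in D) (\sum_(y \in range (g n))
    (y * \1_(g n @^-1` [set y]) x)%:E * (h x)%:E))%E; last first.
  apply: eq_integral => x xD.
  rewrite -ge0_mule_fsuml => [|y]; last exact: nnfun_muleindic_ge0.
  by rewrite fsumEFin // -(fimfunE _ x).
rewrite ge0_integral_fsum//; last 2 first.
  - by move=> y; exact: emeasurable_funM.
  - move=> y x _; apply: mule_ge0; last by rewrite lee_fin.
    exact: nnfun_muleindic_ge0.
apply: eq_fsbigr => r /[!inE] -[t _ <-].
rewrite integralZl_indic_nnsfun// integral_indic//.
under [RHS]eq_integral do rewrite EFinM -muleA.
rewrite ge0_integralZl//; last 3 first.
- by apply: emeasurable_funM => //; apply/measurable_EFinP/measurable_indic.
- by move=> x _; rewrite mule_ge0// lee_fin.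
- by rewrite lee_fin.
congr (_ * _)%E; rewrite /= /density_measure setIC integral_mkcondr.
by apply: eq_integral => x _; rewrite epatch_indic muleC.
Qed.

End DensityMeasure.

Section Translation.
Context {R : realType}.
Local Notation leb := (@lebesgue_measure R).

(** The image of Lebesgue measure under a translation agrees with it on half-open
intervals, which characterises Lebesgue measure. *)
Lemma ge0_integral_translation (y : R) (f : measurableTypeR R -> \bar R) :
  measurable_fun setT f -> (forall x, 0 <= f x)%E ->
  (\int[leb]_x f (x + y)%R = \int[leb]_x f x)%E.
Proof.
move=> mf f0; pose t (x : measurableTypeR R) : measurableTypeR R := x + y.
have mt : measurable_fun setT t by exact: measurable_funD.
pose nu := measure_function_pushforward__canonical__measure_function_Measure
  leb mt.
transitivity (\int[nu]_x f x)%E.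
  by rewrite ge0_integral_pushforward// => x _; exact: f0.
apply: eq_measure_integral => A mA _.
apply/esym/lebesgue_measure_unique => // _ [[a b] _ <-] /=.
rewrite /pushforward/=.
have -> : t @^-1` `]a, b] = `]a - y, b - y]%classic.
  by apply/seteqP; split => x /=; rewrite /t !in_itv/= ltrBlDr lerBrDr.
rewrite !lebesgue_measure_itv/= !lte_fin ltrD2r -!EFinB.
by case: ifP => // _; congr EFin; ring.
Qed.

End Translation.

(** * The Laplace transform determines the measure *)

Section Inversion.
Context {R : realType}.
Implicit Types A B : {measure set (measurableTypeR R) -> \bar R}.

Definition exp_integrable A := forall a : R, 0 < a ->
  A.-integrable `[0, +oo[ (fun x : R => (expR (- (x * a)))%:E).

Definition laplace_measure A (z : R) : R :=
  \int[A]_(x in `[0, +oo[) expR (- (x * z)).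

Lemma integral_exp_combination A (c : R) (a : nat -> R) n :
  0 < c -> exp_integrable A ->
  A.-integrable `[0, +oo[
    (EFin \o fun x : R => \sum_(i < n) a i * expR (- (x * c)) ^+ i.+1) /\
  \int[A]_(x in `[0, +oo[) (\sum_(i < n) a i * expR (- (x * c)) ^+ i.+1) =
  \sum_(i < n) a i * laplace_measure A (i.+1%:R * c).
Proof.
move=> c0 Ai.
have Ei (x : R) i : expR (- (x * c)) ^+ i.+1 = expR (- (x * (i.+1%:R * c))).
  by rewrite -expRM_natl; congr expR; ring.
have Eint i : A.-integrable `[0, +oo[
    (EFin \o fun x : R => expR (- (x * c)) ^+ i.+1).
  apply: eq_integrable (Ai (i.+1%:R * c) _) => //; last by rewrite mulr_gt0.
  by move=> x _ /=; rewrite Ei.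
have aEint i : A.-integrable `[0, +oo[
    (EFin \o fun x : R => a i * expR (- (x * c)) ^+ i.+1).
  by apply: eq_integrable (integrableZl _ (a i) (Eint i)).
elim: n => [|n [IHi IHe]].
  under eq_Rintegral do rewrite big_ord0.
  rewrite big_ord0 Rintegral_cst// mul0r; split => //.
  apply: eq_integrable (integrable0 _ _) => //.
  by move=> x _ /=; rewrite big_ord0.
split.
  apply: eq_integrable (integrableD _ IHi (aEint n)) => //.
  by move=> x _ /=; rewrite big_ord_recr.
under eq_Rintegral do rewrite big_ord_recr.
rewrite big_ord_recr/= RintegralD//= IHe; congr (_ + _).
rewrite RintegralZl//; congr (_ * _).
by apply: eq_Rintegral => x _; rewrite Ei.
Qed.

Lemma exp_integrable_itv_lty A (x : R) :
  exp_integrable A -> (A `[0%R, x]%classic < +oo)%E.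
Proof.
move=> Ai; have Ax : A.-integrable `[0, x] (fun y : R => (expR (- (y * 1)))%:E).
  by apply: integrableS (Ai 1 ltr01) => //; apply: subset_itvl.
have : (\int[A]_(y in `[0%R, x]) (expR (- x))%:E < +oo)%E.
  move/integrableP: Ax => [mE AE]; apply: le_lt_trans AE.
  apply: ge0_le_integral => //.
  - exact: measurableT_comp.
  - move=> y /=; rewrite in_itv/= => /andP[_ yx].
    by rewrite lee_fin ger0_norm ?expR_ge0// ler_expR lerN2 mulr1.
rewrite integral_cst// => h; rewrite ltey; apply/eqP => Aoo; move: h.
by rewrite Aoo mulry gtr0_sg ?expR_gt0// mul1e.
Qed.

(** The polynomials [cutoff n] decide whether v is at least 1/2.  The power
v ^ n.+1 crosses 2 ^- n.+1 at v = 1/2; raising 1 - v ^ n.+1 to the power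
2 ^ n.+1 alone would leave the limit 1 - 1/e at v = 1/2, and the extra factor
n.+1 moves this limit to 1, so that the limiting interval is closed.  They have
no constant term, so they integrate to combinations of transforms at positive
arguments. *)
Definition cutoff_exponent n := (n.+1 * 2 ^ n.+1)%N.
Definition cutoff n (v : R) := 1 - (1 - v ^+ n.+1) ^+ cutoff_exponent n.

Lemma cutoffE n v : cutoff n v =
  v ^+ n.+1 * \sum_(i < cutoff_exponent n) (1 - v ^+ n.+1) ^+ i.
Proof.
rewrite /cutoff -[LHS]opprB subrX1 -mulNr; congr (_ * _); ring.
Qed.

Lemma cutoff_itv01 n v : 0 <= v <= 1 -> 0 <= cutoff n v <= 1.
Proof.
move=> /andP[v0 v1]; rewrite /cutoff subr_ge0 lerBlDr lerDl.
have V1 : 0 <= 1 - v ^+ n.+1 by rewrite subr_ge0 exprn_ile1.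
have V2 : 1 - v ^+ n.+1 <= 1 by rewrite lerBlDr lerDl exprn_ge0.
by rewrite exprn_ile1//= exprn_ge0.
Qed.

Lemma cutoff_le n v : 0 <= v <= 1 -> cutoff n v <= n.+1%:R * (2 * v) ^+ n.+1.
Proof.
move=> /andP[v0 v1].
have V1 : 0 <= 1 - v ^+ n.+1 by rewrite subr_ge0 exprn_ile1.
have V2 : 1 - v ^+ n.+1 <= 1 by rewrite lerBlDr lerDl exprn_ge0.
rewrite cutoffE (@le_trans _ _ (v ^+ n.+1 * \sum_(i < cutoff_exponent n) 1))//.
  rewrite ler_wpM2l ?exprn_ge0//; apply: ler_sum => i _.
  by rewrite exprn_ile1.
rewrite sumr_const card_ord /cutoff_exponent natrM natrX exprMn mulrC.
by rewrite -mulrA.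
Qed.

(** For v < 1/8, the bound [cutoff_le] is 2 v times n.+1 (2 v) ^ n, which is at
most n.+1 2 ^- n, hence at most 1. *)
Lemma cutoff_dominated n v : 0 <= v <= 1 -> cutoff n v <= 8 * v.
Proof.
move=> v01; have /andP[v0 v1] := v01.
have [v8|v8] := leP 8^-1 v.
  have /andP[_ /le_trans] := cutoff_itv01 n v01; apply; lra.
apply: (le_trans (cutoff_le n v01)).
have : n.+1%:R * (2 * v) ^+ n <= 1.
  apply: (@le_trans _ _ (2 ^+ n * 2^-1 ^+ n)); last first.
    by rewrite -exprMn divff// expr1n.
  apply: ler_pM => //; first by rewrite exprn_ge0// mulr_ge0.
    by rewrite -natrX ler_nat ltn_expl.
  apply: lerXn2r; rewrite ?nnegrE; lra.
move=> h; rewrite exprSr mulrA (@le_trans _ _ (1 * (2 * v)))//; last by lra.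
by rewrite ler_wpM2r//; lra.
Qed.

(** Since 1 - y <= exp(- y), the power is at most
exp(- n.+1 (2 v) ^ n.+1) <= exp(- n.+1). *)
Lemma cutoff_cvg1 v : 2^-1 <= v <= 1 -> cutoff n v @[n --> \oo] --> (1 : R).
Proof.
move=> /andP[v2 v1].
rewrite -[X in _ --> X]subr0; apply: cvgB; first exact: cvg_cst.
apply: (@squeeze_cvgr _ _ _ _ (cst 0) (fun n => expR (- 1) ^+ n.+1)).
- apply: nearW => n.
  have V1 : 0 <= 1 - v ^+ n.+1 by rewrite subr_ge0 exprn_ile1//; lra.
  rewrite exprn_ge0//=.
  rewrite (@le_trans _ _ (expR (- v ^+ n.+1) ^+ cutoff_exponent n))//.
    by rewrite lerXn2r// ?nnegrE ?expR_ge0//; exact: expR_ge1Dx.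
  rewrite -!expRM_natl ler_expR mulrN1 mulrN lerN2 /cutoff_exponent natrM.
  rewrite -mulrA ler_peMr//.
  rewrite natrX -exprMn -[X in X <= _](expr1n _ n.+1).
  by apply: lerXn2r; rewrite ?nnegrE; lra.
- exact: cvg_cst.
  rewrite (cvg_shiftS (fun n => expR (- 1) ^+ n)).
  apply: cvg_expr; rewrite ger0_norm ?expR_ge0// -expR0 ltr_expR; lra.
Qed.

(** A square is used because n s ^ n is at most 1 + s + ... + s ^ n.-1, hence at
most 1 / (1 - s), which leaves the factor s ^ n to go to 0. *)
Lemma natr_expr_cvg0 (s : R) : 0 <= s < 1 ->
  n%:R * (s ^+ 2) ^+ n @[n --> \oo] --> (0 : R).
Proof.
move=> /andP[s0 s1].
apply: (@squeeze_cvgr _ _ _ _ (cst 0) (fun n => (1 - s)^-1 * s ^+ n)).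
- apply: nearW => n; rewrite mulr_ge0 ?exprn_ge0//=.
  rewrite -exprM mulnC muln2 -addnn exprD mulrA.
  rewrite ler_wpM2r ?exprn_ge0// -[leRHS]mul1r ler_pdivlMr ?subr_gt0//.
  have : \sum_(i < n) s ^+ n <= \sum_(i < n) s ^+ i.
    by apply: ler_sum => i _; apply: ler_wiXn2l; [by []|exact: ltW|exact: ltnW].
  rewrite sumr_const card_ord => hs; rewrite -[_ ^+ _ *+ _]mulr_natl in hs.
  apply: (le_trans (ler_wpM2r _ hs)); first by rewrite subr_ge0 ltW.
  have e := subrX1 s n.
  have -> : (\sum_(i < n) s ^+ i) * (1 - s) = 1 - s ^+ n.
    by rewrite -[RHS]opprB e; ring.
  by rewrite lerBlDr lerDl exprn_ge0.
- exact: cvg_cst.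
- rewrite -(mulr0 (1 - s)^-1); apply: cvgM; first exact: cvg_cst.
  by apply: cvg_expr; rewrite ger0_norm.
Qed.

Lemma cutoff_cvg0 v : 0 <= v < 2^-1 -> cutoff n v @[n --> \oo] --> (0 : R).
Proof.
move=> /andP[v0 v2].
apply: (@squeeze_cvgr _ _ _ _ (cst 0) (fun n => n.+1%:R * (2 * v) ^+ n.+1)).
- apply: nearW => n; rewrite cutoff_le ?andbT; last by lra.
  by have /andP[] := @cutoff_itv01 n v ltac:(lra).
- exact: cvg_cst.
  rewrite (cvg_shiftS (fun n => n%:R * (2 * v) ^+ n)).
  rewrite -[2 * v]sqr_sqrtr; last by lra.
  apply: natr_expr_cvg0; rewrite sqrtr_ge0/= -[ltRHS]sqrtr1 ltr_sqrt//; lra.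
Qed.

(** The coefficients depend on n alone, so two measures with the same transform
give the same integrals. *)
Lemma integral_cutoff n : exists N (a : nat -> R), forall A (b : R), 0 < b ->
  exp_integrable A ->
  \int[A]_(x in `[0, +oo[) (cutoff n (expR (- (x * b)))) =
  \sum_(i < N) a i * laplace_measure A (i.+1%:R * (n.+1%:R * b)).
Proof.
pose P : {poly R} := \sum_(i < cutoff_exponent n) (1 - 'X) ^+ i.
exists (size P), (fun i => P`_i) => A b b0 Ai.
have c0 : 0 < n.+1%:R * b by rewrite mulr_gt0.
rewrite -(integral_exp_combination _ _ c0 Ai).2.
apply: eq_Rintegral => x _; rewrite cutoffE.
have -> : expR (- (x * b)) ^+ n.+1 = expR (- (x * (n.+1%:R * b))).
  by rewrite -expRM_natl; congr expR; ring.
set w := expR _; transitivity (w * P.[w]).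
  congr (_ * _); rewrite /P horner_sum; apply: eq_bigr => i _.
  by rewrite !hornerE.
rewrite horner_coef mulr_sumr; apply: eq_bigr => i _.
by rewrite exprS; ring.
Qed.

(** With b = ln 2 / x, the condition exp(- y b) >= 1/2 says that y <= x. *)
Lemma cvg_integral_cutoff A (x : R) : 0 < x -> exp_integrable A ->
  \int[A]_(y in `[0, +oo[) (cutoff n (expR (- (y * (ln 2 / x)))))
    @[n --> \oo] --> fine (A `[0, x]%classic).
Proof.
move=> x0 Ai; pose b : R := ln 2 / x.
have b0 : 0 < b by rewrite divr_gt0// ln_gt0// ltr1n.
have eb y : 0 <= y -> 0 <= expR (- (y * b)) <= 1.
  by move=> y0; rewrite expR_ge0/= -expR0 ler_expR lerNl oppr0 mulr_ge0// ltW.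
have mE : measurable_fun (`[0, +oo[%classic : set (measurableTypeR R))
    (fun y : measurableTypeR R => expR (- (y * b))).
  have /measurable_int/measurable_EFinP := Ai b b0; exact.
have mH n : measurable_fun (`[0, +oo[%classic : set (measurableTypeR R))
    (fun y : measurableTypeR R => cutoff n (expR (- (y * b)))).
  rewrite /cutoff; apply: measurable_funB => //; apply: measurable_funX.
  by apply: measurable_funB => //; exact: measurable_funX.
have : (\int[A]_(y in `[0%R, +oo[) (cutoff n (expR (- (y * b))))%:E)%E
    @[n --> \oo] --> (\int[A]_(y in `[0%R, +oo[)
      (\1_(`[0%R, x]%classic : set (measurableTypeR R)) y)%:E)%E.
  apply: (@dominated_cvg _ _ _ A `[0, +oo[%classic _
    (fun n (y : measurableTypeR R) => (cutoff n (expR (- (y * b))))%:E)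
    (fun y : measurableTypeR R =>
      (\1_(`[0, x]%classic : set (measurableTypeR R)) y)%:E)
    (fun y => (8 * expR (- (y * b)))%:E)) => //.
  - by move=> n; exact/measurable_EFinP.
  - move=> y /=; rewrite in_itv/= andbT => y0.
    apply/cvg_EFin; first by exact: nearW.
    rewrite /comp/=.
    have [yx|xy] := leP y x.
      rewrite indicE mem_set/=; last by rewrite in_itv/= y0.
      apply: cutoff_cvg1; rewrite (andP (eb _ y0)).2 andbT.
      rewrite -[leLHS]lnK ?posrE ?invr_gt0// ler_expR lnV ?posrE// lerN2.
      rewrite /b mulrCA -[leRHS]mulr1 ler_wpM2l//.
        by rewrite ln_ge0// ler1n.
      by rewrite ler_pdivrMr ?mul1r.
    rewrite indicE memNset/=; last by rewrite in_itv/= y0 leNgt xy.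
    apply: cutoff_cvg0; rewrite expR_ge0/=.
    rewrite -[ltRHS]lnK ?posrE ?invr_gt0// ltr_expR lnV ?posrE// ltrN2.
    rewrite /b mulrCA -[ltLHS]mulr1 ltr_pM2l ?ln_gt0 ?ltr1n//.
    by rewrite ltr_pdivlMr ?mul1r.
  - by have := integrableZl _ 8 (Ai b b0); exact.
  - move=> n y /=; rewrite in_itv/= andbT => y0.
    have /andP[h0 _] := cutoff_itv01 n (eb _ y0).
    by rewrite lee_fin ger0_norm//; exact: cutoff_dominated (eb _ y0).
rewrite integral_indic// setIidl; last by apply: subset_itvl.
rewrite -[A _]fineK; first exact: fine_cvg.
by rewrite ge0_fin_numE// exp_integrable_itv_lty.
Qed.

(** The inversion formula is available for x > 0; the mass of the point 0 is then
obtained by letting x decrease to 0. *)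
Lemma laplace_measure_inj A B : exp_integrable A -> exp_integrable B ->
  (forall z, 0 < z -> laplace_measure A z = laplace_measure B z) ->
  forall x, 0 <= x -> fine (A `[0, x]%classic) = fine (B `[0, x]%classic).
Proof.
move=> Ai Bi AB.
have pos x : 0 < x -> fine (A `[0, x]%classic) = fine (B `[0, x]%classic).
  move=> x0; have b0 : 0 < ln 2 / x by rewrite divr_gt0// ln_gt0// ltr1n.
  have E n : \int[A]_(y in `[0, +oo[) (cutoff n (expR (- (y * (ln 2 / x))))) =
      \int[B]_(y in `[0, +oo[) (cutoff n (expR (- (y * (ln 2 / x))))).
    have [N [a aE]] := integral_cutoff n.
    rewrite !aE//; apply: eq_bigr => i _.
    by rewrite AB// mulr_gt0// mulr_gt0.
  apply: (cvg_unique _ (cvg_integral_cutoff x0 Ai)) => //.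
  by rewrite /= (eq_cvg _ _ E); exact: cvg_integral_cutoff.
move=> x; rewrite le_eqVlt => /predU1P[<-|]; last exact: pos.
pose F n : set (measurableTypeR R) := `[0, n.+1%:R^-1]%classic.
have F0 : \bigcap_n F n = `[0, 0]%classic.
  apply/seteqP; split => y /=.
    move=> Fy; have := Fy 0%N I; rewrite /F/= !in_itv/= => /andP[-> _]/=.
    rewrite leNgt; apply/negP => y0.
    have [n _ ny] := near_infty_natSinv_lt (PosNum y0); have := ny n (leqnn n).
    have := Fy n I; rewrite /F/= in_itv/= => /andP[_ yn].
    by rewrite ltNge yn.
  by rewrite in_itv/= => /le_anti <- n _; rewrite /F/= in_itv/= lexx invr_ge0 ler0n.
have cvgF C : exp_integrable C ->
    fine (C (F n)) @[n --> \oo] --> fine (C `[0, 0]%classic).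
  move=> Ci; apply: fine_cvg; rewrite fineK; last first.
    by rewrite ge0_fin_numE// exp_integrable_itv_lty.
  rewrite -F0; apply: nonincreasing_cvg_mu => //.
  - exact: exp_integrable_itv_lty.
  - by move=> i; exact: measurable_itv.
  - by rewrite F0; exact: measurable_itv.
  - move=> m n mn; apply/subsetPset => y; rewrite /F/= !in_itv/=.
    move=> /andP[-> /le_trans]; apply; rewrite lef_pV2 ?posrE//.
    by rewrite ler_nat.
apply: (cvg_unique _ (cvgF _ Ai)) => //.
have FE n : fine (A (F n)) = fine (B (F n)) by rewrite /F pos// invr_gt0.
by rewrite /= (eq_cvg _ _ FE); exact: cvgF.
Qed.

End Inversion.

(** * Densities with exponential moments *)

Section Densities.
Context {R : realType}.
Local Notation leb := (@lebesgue_measure R).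
Local Notation Rp := (`[0%R, +oo[%classic : set (measurableTypeR R)).
Implicit Types (A B : {measure set (measurableTypeR R) -> \bar R}).
Implicit Types (q r : R -> R).

Lemma measurable_expN (D : set (measurableTypeR R)) (z : R) :
  measurable_fun D (fun x : measurableTypeR R => expR (- (x * z))).
Proof.
apply: measurableT_comp => //; apply: measurableT_comp => //.
exact: measurable_funM.
Qed.

Definition exp_density (q : R -> R) := forall a : R, 0 < a ->
  leb.-integrable Rp (EFin \o fun x : R => q x * expR (- (x * a))).

Definition laplace_density (q : R -> R) (z : R) : R :=
  \int[leb]_(x in Rp) (q x * expR (- (x * z))).

Lemma exp_density_measurable q : exp_density q -> measurable_fun Rp q.
Proof.
move=> /(_ 1 ltr01)/measurable_int/measurable_EFinP mq.
apply: (eq_measurable_fun (fun x => q x * expR (- (x * 1)) * expR (- (x * (- 1))))).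
  by move=> x _; rewrite -mulrA -expRD mulrN opprK addNr expR0 mulr1.
by apply: measurable_funM => //; exact: measurable_expN.
Qed.

Lemma exp_densityP q : measurable_fun Rp q ->
  (forall a : R, 0 < a ->
    (\int[leb]_(x in Rp) (`|q x| * expR (- (x * a)))%:E < +oo)%E) ->
  exp_density q.
Proof.
move=> mq qoo a a0; apply/integrableP; split.
  by apply/measurable_EFinP/measurable_funM => //; exact: measurable_expN.
under eq_integral do rewrite /= normrM (ger0_norm (expR_ge0 _)).
exact: qoo.
Qed.

Lemma exp_densityD q r : exp_density q -> exp_density r ->
  exp_density (fun x => q x + r x) /\
  forall z, 0 < z -> laplace_density (fun x => q x + r x) z =
    laplace_density q z + laplace_density r z.
Proof.
move=> iq ir; split=> [a a0|z z0].
  apply: eq_integrable (integrableD _ (iq a a0) (ir a a0)) => //.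
  by move=> x _ /=; rewrite mulrDl.
rewrite /laplace_density -RintegralD//; [|exact: iq|exact: ir].
by apply: eq_Rintegral => x _ /=; rewrite mulrDl.
Qed.

Lemma exp_densityZ k q : exp_density q ->
  exp_density (fun x => k * q x) /\
  forall z, 0 < z -> laplace_density (fun x => k * q x) z =
    k * laplace_density q z.
Proof.
move=> iq; split=> [a a0|z z0].
  apply: eq_integrable (integrableZl _ k (iq a a0)) => //.
  by move=> x _ /=; rewrite -EFinM mulrA.
rewrite /laplace_density -RintegralZl//; last exact: iq.
by apply: eq_Rintegral => x _ /=; rewrite mulrA.
Qed.

Lemma exp_densityB q r : exp_density q -> exp_density r ->
  exp_density (fun x => q x - r x) /\
  forall z, 0 < z -> laplace_density (fun x => q x - r x) z =
    laplace_density q z - laplace_density r z.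
Proof.
move=> iq ir; have [i1 l1] := exp_densityZ (- 1) ir.
have [i2 l2] := exp_densityD iq i1.
have -> : (fun x => q x - r x) = (fun x => q x + - 1 * r x).
  by apply/funext => x; rewrite mulN1r.
by split=> // z z0; rewrite l2// l1// mulN1r.
Qed.

Lemma exp_density_integrable_itv q (b : R) : exp_density q ->
  leb.-integrable `[0, b] (EFin \o q).
Proof.
move=> iq; have mq := exp_density_measurable iq.
have sub : `[0, b] `<=` Rp by apply: subset_itvl.
have i1 : leb.-integrable `[0, b] (EFin \o fun x => q x * expR (- (x * 1))).
  by apply: integrableS (iq 1 ltr01).
have := integrableZl _ (expR b) i1; move/(_ (measurable_itv _)).
apply: le_integrable => //.
  by apply/measurable_EFinP; apply: measurable_funS sub mq.
move=> x /=; rewrite in_itv/= => /andP[_ xb].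
rewrite lee_fin !normrM !(ger0_norm (expR_ge0 _)) mulrCA -expRD mulr1.
by rewrite ler_peMr// -expR0 ler_expR subr_ge0.
Qed.

(** Radon-Nikodym applied to the finite measure exp(- x) A, whose density is then
multiplied by exp(x). *)
Lemma dominated_has_density A : exp_integrable A -> A `<< leb ->
  exists q, exp_density q /\
    forall z, 0 < z -> laplace_measure A z = laplace_density q z.
Proof.
move=> Ai Aleb.
pose h (x : measurableTypeR R) : R := \1_Rp x * expR (- (x * 1)).
have mh : measurable_fun setT h.
  by apply: measurable_funM => //; exact: measurable_expN.
have h0 x : 0 <= h x by rewrite mulr_ge0 ?expR_ge0.
have nuoo : (density_measure A mh h0 setT < +oo)%E.
  rewrite /density_measure.
  have /integrableP[_] := Ai 1 ltr01.
  rewrite [X in (X < _)%E]integral_mkcond; congr (_ < _)%E.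
  apply: eq_integral => x _; rewrite patchE /h indicE.
  by case: ifPn => _; rewrite ?mul0r ?mul1r//= ger0_norm// expR_ge0.
have nufin : fin_num_fun (density_measure A mh h0).
  move=> N mN; rewrite ge0_fin_numE//; apply: le_lt_trans nuoo.
  by apply: le_measure; rewrite ?inE.
pose nu : {finite_measure set (measurableTypeR R) -> \bar R} :=
  HB.pack (density_measure A mh h0) (Measure_isFinite.Build _ _ _ _ nufin).
have nuleb : nu `<< leb.
  apply/null_content_dominatesP => N mN N0; rewrite /nu/= /density_measure.
  apply: null_set_integral => //; last first.
    by move/null_content_dominatesP : Aleb; exact.
  exact/measurable_EFinP/measurable_funTS.
have [r [r0 rfin ri nur]] := radon_nikodym_sigma_finite nuleb.
have mr : measurable_fun setT (fine \o r).
  apply/measurable_EFinP; apply: eq_measurable_fun (measurable_int _ ri).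
  by move=> x _ /=; rewrite fineK.
have fr0 x : 0 <= fine (r x) by rewrite fine_ge0.
pose q x := fine (r x) * expR (- (x * (- 1))).
have E z : 0 < z -> (\int[A]_(x in Rp) (expR (- (x * z)))%:E =
    \int[leb]_(x in Rp) (q x * expR (- (x * z)))%:E)%E.
  move=> z0.
  pose g (x : measurableTypeR R) := expR (- (x * (-1))) * expR (- (x * z)).
  have mg (D : set (measurableTypeR R)) : measurable_fun D g.
    by apply: measurable_funM => //; exact: measurable_expN.
  have g0 x : 0 <= g x by rewrite mulr_ge0 ?expR_ge0.
  transitivity (\int[nu]_(x in Rp) (g x)%:E)%E.
    rewrite integral_density//; last 2 first.
      exact/measurable_EFinP.
      by move=> x _; rewrite lee_fin.
    apply: eq_integral => x xD; rewrite -EFinM /h indicE xD mul1r /g.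
    congr EFin; rewrite mulrAC -expRD mulrN opprK.
    by rewrite mulr1 subrr expR0 mul1r.
  transitivity (\int[density_measure leb mr fr0]_(x in Rp) (g x)%:E)%E.
    apply: eq_measure_integral => N mN _; apply: (etrans (nur N mN)).
    by apply: eq_integral => x _; rewrite /= fineK.
  rewrite integral_density//; last 2 first.
    exact/measurable_EFinP.
    by move=> x _; rewrite lee_fin.
  by apply: eq_integral => x xD; rewrite -EFinM /g /q; congr EFin => /=; ring.
exists q; split; last by move=> z z0; rewrite /laplace_measure/Rintegral E.
apply: exp_densityP.
  by apply: measurable_funM; [exact: measurable_funTS|exact: measurable_expN].
move=> a a0.
under eq_integral do rewrite ger0_norm ?mulr_ge0 ?expR_ge0//.
rewrite -E//; have /integrableP[_] := Ai a a0.
by under eq_integral do rewrite /= ger0_norm ?expR_ge0//.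
Qed.

End Densities.

(** * The Radon measure with a given density and a given atom at 0 *)

Section RadonOfDensity.
Context {R : realType}.
Local Notation leb := (@lebesgue_measure R).
Local Notation Rp := (`[0%R, +oo[%classic : set (measurableTypeR R)).

Lemma Rintegral_indic_itv (x : R) (g : R -> R) :
  \int[leb]_(u in Rp) (\1_(`[0, x]%classic) u * g u) =
  \int[leb]_(u in `[0, x]) g u.
Proof.
rewrite (_ : `[0, x]%classic = Rp `&` `[0, x]); last first.
  by rewrite setIidr//; apply: subset_itvl.
rewrite Rintegral_mkcondr; apply: eq_Rintegral => u.
rewrite inE/= => u0; rewrite patchE indicE in_setI.
have -> : (u \in Rp) = true by apply/mem_set.
by rewrite /=; case: ifP; rewrite ?mul1r ?mul0r.
Qed.

Section PositivePart.
Variables (q : R -> R) (c : R).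
Hypothesis iq : exp_density q.

Let m0 := measure_add leb (@dirac _ (measurableTypeR R) 0 R).

(** A density with respect to the sum of Lebesgue measure and the unit mass at 0:
its value at 0 is not seen by Lebesgue measure, so it can carry the atom. *)
Definition atom_density (x : measurableTypeR R) : R :=
  if x == 0 then c else (q \_ Rp) x.

Lemma measurable_atom_density : measurable_fun setT atom_density.
Proof.
have mq : measurable_fun setT (q \_ Rp).
  by apply/measurable_restrict => //; rewrite setTI; exact: exp_density_measurable.
apply: measurable_fun_ifT => //.
apply: (measurable_fun_bool true); rewrite setTI.
rewrite (_ : _ @^-1` _ = [set (0 : measurableTypeR R)]); first exact: measurable_set1.
by apply/seteqP; split => x /= /eqP.
Qed.

Definition pos_density x : R := Num.max (atom_density x) 0.

Lemma measurable_pos_density : measurable_fun setT pos_density.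
Proof. exact: measurable_maxr measurable_atom_density (measurable_cst _). Qed.

Lemma pos_density_ge0 x : 0 <= pos_density x.
Proof. by rewrite /pos_density le_max lexx orbT. Qed.

(** The positive part of the signed measure with density q and atom c; the
negative part is obtained from -q and -c. *)
Definition pos_measure : {measure set (measurableTypeR R) -> \bar R} :=
  density_measure m0 measurable_pos_density pos_density_ge0.

Lemma integral_pos_measure (f : measurableTypeR R -> R) :
  measurable_fun Rp f -> (forall x, 0 <= x -> 0 <= f x) ->
  (\int[pos_measure]_(x in Rp) (f x)%:E =
   \int[leb]_(x in Rp) (f x * Num.max (q x) 0)%:E + (f 0 * Num.max c 0)%:E)%E.
Proof.
move=> mf f0; have mp : measurable_fun Rp pos_density.
  by apply: measurable_funTS; exact: measurable_pos_density.
have mfp : measurable_fun Rp (EFin \o (fun x => f x * pos_density x)).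
  exact/measurable_EFinP/measurable_funM.
have f0' x : Rp x -> (0 <= (f x)%:E)%E.
  by rewrite /= in_itv/= andbT lee_fin; exact: f0.
rewrite integral_density//; last exact/measurable_EFinP.
under eq_integral do rewrite -EFinM.
rewrite ge0_integral_measure_add//; last first.
  by move=> x xp; rewrite EFinM mule_ge0 ?f0'// lee_fin pos_density_ge0.
congr (_ + _)%E.
  have sub : [set` `]0, +oo[ ] `<=` Rp.
    by move=> y /=; rewrite !in_itv/= !andbT; exact: ltW.
  rewrite -integral_itv_obnd_cbnd; last by apply: measurable_funS sub mfp.
  rewrite -[RHS]integral_itv_obnd_cbnd; last first.
    apply: measurable_funS sub _ => //; apply/measurable_EFinP.
    apply: measurable_funM => //; apply: measurable_maxr => //.
    exact: exp_density_measurable.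
  apply: eq_integral => x; rewrite inE/= in_itv/= andbT => x0.
  rewrite /pos_density /atom_density gt_eqF// patchE mem_set//=.
  by rewrite in_itv/= andbT ltW.
rewrite integral_dirac//= diracE mem_set//=.
  by rewrite mul1e /pos_density /atom_density eqxx.
by rewrite in_itv/= lexx.
Qed.

Lemma pos_measure_lt0 : pos_measure `]-oo, 0[%classic = 0%E.
Proof.
rewrite /pos_measure/= /density_measure integral0_eq// => x /=.
rewrite in_itv/= => x0; rewrite /pos_density /atom_density lt_eqF//.
by rewrite patchE memNset ?maxxx//= in_itv/= andbT leNgt x0.
Qed.

Lemma max0_exp_density : exp_density (fun x => Num.max (q x) 0).
Proof.
have mq := exp_density_measurable iq.
move=> a a0; apply: le_integrable (iq a0) => //.
  apply/measurable_EFinP/measurable_funM; last exact: measurable_expN.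
  exact: measurable_maxr.
move=> x _ /=; rewrite lee_fin !normrM ler_wpM2r//.
by case: (leP (q x) 0) => h; rewrite ?normr0.
Qed.

Lemma integral_pos_measure_fin (f : measurableTypeR R -> R) :
  measurable_fun Rp f -> (forall x, 0 <= x -> 0 <= f x) ->
  leb.-integrable Rp (EFin \o fun x => f x * Num.max (q x) 0) ->
  pos_measure.-integrable Rp (EFin \o f) /\
  \int[pos_measure]_(x in Rp) f x =
   \int[leb]_(x in Rp) (f x * Num.max (q x) 0) + f 0 * Num.max c 0.
Proof.
move=> mf f0 fi; have E := integral_pos_measure mf f0; split.
  apply/integrableP; split; first exact/measurable_EFinP.
  rewrite (eq_integral (fun x => (f x)%:E)); last first.
    move=> x; rewrite inE/= in_itv/= andbT => x0.
    by rewrite ger0_norm ?f0.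
  rewrite E lte_add_pinfty// ?ltry// -ge0_fin_numE; last first.
    apply: integral_ge0 => x /=; rewrite in_itv/= andbT => x0.
    by rewrite lee_fin mulr_ge0 ?f0// le_max lexx orbT.
  exact: integrable_fin_num fi.
by rewrite /Rintegral E fineD//; exact: integrable_fin_num fi.
Qed.

Lemma pos_measure_exp a : 0 < a ->
  pos_measure.-integrable Rp (EFin \o fun x : R => expR (- (x * a))) /\
  laplace_measure pos_measure a =
    laplace_density (fun x => Num.max (q x) 0) a + Num.max c 0.
Proof.
move=> a0; have [] := @integral_pos_measure_fin (fun x => expR (- (x * a))).
- exact: measurable_expN.
- by move=> x _; exact: expR_ge0.
- apply: eq_integrable (max0_exp_density a0) => //.
  by move=> x _ /=; rewrite mulrC.
move=> ? E; split => //; rewrite /laplace_measure E mul0r oppr0 expR0 mul1r.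
by congr (_ + _); apply: eq_Rintegral => x _; rewrite mulrC.
Qed.

Lemma pos_measure_itv x : 0 <= x ->
  fine (pos_measure `[0, x]%classic) =
    \int[leb]_(u in `[0, x]) Num.max (q u) 0 + Num.max c 0.
Proof.
move=> x0; pose f : measurableTypeR R -> R := \1_(`[0, x]%classic).
have [] := @integral_pos_measure_fin f.
- exact: measurable_indic.
- by move=> y _; rewrite /f indicE.
- apply: le_integrable (integrableZl _ (expR x) (max0_exp_density ltr01)) => //.
    apply/measurable_EFinP/measurable_funM; first exact: measurable_indic.
    apply: measurable_maxr => //; exact: exp_density_measurable.
  move=> y _ /=; rewrite lee_fin !normrM /f indicE.
  have [/set_mem/=|_] := boolP (y \in _); last first.
    by rewrite normr0 mul0r !mulr_ge0.
  rewrite in_itv/= => /andP[_ yx]; rewrite normr1 mul1r mulrCA.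
  rewrite !(ger0_norm (expR_ge0 _)) -expRD mulr1 ler_peMr//.
  by rewrite -expR0 ler_expR subr_ge0.
move=> _; rewrite Rintegral_indic_itv /f indicE mem_set ?mul1r => [<-|]; last first.
  by rewrite /= in_itv/= lexx.
rewrite /Rintegral integral_indic// setIidl//.
by apply: subset_itvl.
Qed.

(** A compact set lies in ]-oo, 0[ `|` [0, r], the first part being null and the
second of finite mass by the exponential moments. *)
Lemma pos_measure_compact (K : set R) : compact K -> (pos_measure K < +oo)%E.
Proof.
move=> Kc; have [M [Mr KM]] := compact_bounded Kc.
pose r := `|M| + 1.
have rM : M < r by rewrite (le_lt_trans (ler_norm _))// ltrDl.
have KM' : K `<=` `]-oo, 0[ `|` `[0, r].
  move=> y Ky; have := KM r rM y Ky => /= /(le_trans (ler_norm _)) yr.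
  by rewrite !in_itv/= yr andbT; case: (ltP y 0); [left|right].
have pe : exp_integrable pos_measure.
  by move=> a a0; have [] := pos_measure_exp a0.
apply: (@le_lt_trans _ _ (pos_measure (`]-oo, 0[ `|` `[0%R, r]))).
  apply: le_measure; rewrite ?inE//; first exact: compact_measurable.
  exact: measurableU.
apply: (le_lt_trans (measureU2 _ _ _)) => //.
rewrite [X in (X + _ < _)%E](_ : _ = 0%E); last exact: pos_measure_lt0.
by rewrite add0e exp_integrable_itv_lty.
Qed.

Lemma pos_measure_dominated : c <= 0 -> pos_measure `<< leb.
Proof.
move=> c0; apply/null_content_dominatesP => N mN N0.
have mp (D : set (measurableTypeR R)) : measurable_fun D (EFin \o pos_density).
  by apply/measurable_EFinP; apply: measurable_funTS; exact: measurable_pos_density.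
rewrite /pos_measure/= /density_measure ge0_integral_measure_add//; last first.
  by move=> x _; rewrite lee_fin pos_density_ge0.
rewrite null_set_integral// add0e integral_dirac//.
by rewrite /pos_density /atom_density eqxx max_r// mule0.
Qed.

End PositivePart.

Lemma exp_densityN (q : R -> R) : exp_density q -> exp_density (fun x => - q x).
Proof.
move=> /(exp_densityZ (- 1))[+ _]; congr (exp_density _).
by apply/funext => x; rewrite mulN1r.
Qed.

Lemma subr_max0 (a : R) : Num.max a 0 - Num.max (- a) 0 = a.
Proof.
by have [a0|a0] := leP a 0; have [b0|b0] := leP (- a) 0; lra.
Qed.

(** The two parts are concentrated where the density is positive, respectively
negative. *)
Lemma pos_measure_singular (q : R -> R) c (iq : exp_density q)
    (iq' : exp_density (fun x => - q x)) :
  exists P : set (measurableTypeR R),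
    [/\ measurable P, pos_measure c iq (~` P) = 0%E
      & pos_measure (- c) iq' P = 0%E].
Proof.
exists [set x | 0 < atom_density q c x]; split.
- rewrite -[X in measurable X]setTI.
  rewrite (_ : [set x | _] = atom_density q c @^-1` `]0, +oo[); last first.
    by apply/seteqP; split => x /=; rewrite in_itv/= andbT.
  by apply: measurable_atom_density => //; exact: measurable_itv.
- rewrite /pos_measure/= /density_measure integral0_eq// => x /=.
  by move=> /negP; rewrite -leNgt /pos_density => h; rewrite max_r.
- rewrite /pos_measure/= /density_measure integral0_eq// => x /= h.
  rewrite /pos_density max_r//; move: h; rewrite /atom_density.
  case: ifPn => _; first by rewrite oppr_le0 => /ltW.
  by rewrite !patchE; case: ifPn => _; rewrite ?ltxx// oppr_le0 => /ltW.
Qed.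

Lemma radon_of_density (q : R -> R) (c : R) : exp_density q ->
  exists mu : real_radon R,
  [/\ exp_moments mu,
      forall z, laplace mu z = laplace_density q z%:num + c,
      forall x, cumul mu x = c + \int[leb]_(u in `[0, x%:num]) q u
    & c = 0 -> tvar mu `<< leb].
Proof.
move=> iq; have iq' := exp_densityN iq.
pose mu := @RealRadon R (pos_measure c iq) (pos_measure (- c) iq')
  (pos_measure_lt0 _ _) (pos_measure_lt0 _ _)
  (@pos_measure_compact _ _ _) (@pos_measure_compact _ _ _)
  (pos_measure_singular _ _ _).
exists mu; split.
- move=> a a0; rewrite /tvar ge0_integral_measure_add//; last first.
    rewrite (_ : (fun _ => _) = EFin \o fun x : measurableTypeR R =>
        expR (- (x * a))); last by apply/funext => x; rewrite /= mulrC.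
    by apply/measurable_EFinP; exact: measurable_expN.
  have h r d (ir : exp_density r) :
      (\int[pos_measure d ir]_(x in Rp) (expR (- (a * x)))%:E < +oo)%E.
    have [/integrableP[_] + _] := pos_measure_exp d ir a0.
    congr (_ < _)%E; apply: eq_integral => x _.
    by rewrite /= ger0_norm ?expR_ge0// mulrC.
  by rewrite lte_add_pinfty//; exact: h.
- move=> z; rewrite /laplace -!/(laplace_measure _ _)/=.
  rewrite (pos_measure_exp c iq _).2// (pos_measure_exp (- c) iq' _).2//.
  rewrite opprD addrACA subr_max0; congr (_ + _).
  have [_ <-//] := exp_densityB (max0_exp_density iq) (max0_exp_density iq').
  by congr (laplace_density _ _); apply/funext => x; exact: subr_max0.
- move=> x; rewrite /cumul /radon_val/= !pos_measure_itv//.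
  rewrite opprD addrACA subr_max0 addrC; congr (_ + _).
  rewrite -RintegralB//.
  + by apply: eq_Rintegral => u _; rewrite subr_max0.
  + by apply: exp_density_integrable_itv; exact: max0_exp_density.
  + by apply: exp_density_integrable_itv; exact: max0_exp_density.
- move=> c0; apply/null_content_dominatesP => N mN N0.
  apply: (etrans (measure_addE (mpos mu) (mneg mu) N)).
  have h r d (ir : exp_density r) : d <= 0 -> pos_measure d ir N = 0%E.
    by move=> /(pos_measure_dominated ir)/null_content_dominatesP; exact.
  by rewrite /= !h ?adde0// c0 ?oppr0.
Qed.

End RadonOfDensity.

(** * Convolution of a measure with a density *)

Section Convolution.
Context {R : realType}.
Local Notation leb := (@lebesgue_measure R).
Local Notation T := (measurableTypeR R).
Local Notation Rp := (`[0%R, +oo[%classic : set (measurableTypeR R)).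

Lemma integral_translation (y : R) (f : T -> \bar R) : measurable_fun setT f ->
  (\int[leb]_x f (x + y)%R = \int[leb]_x f x)%E.
Proof.
move=> mf; rewrite integralE [RHS]integralE; congr (_ - _)%E.
  have h : (forall x, 0 <= f^\+ x)%E by [].
  have H := ge0_integral_translation y (measurable_funepos mf) h.
  by rewrite -H; apply: eq_integral => x _; rewrite !funeposE.
have h : (forall x, 0 <= f^\- x)%E by [].
have H := ge0_integral_translation y (measurable_funeneg mf) h.
by rewrite -H; apply: eq_integral => x _; rewrite !funenegE.
Qed.

Section Restriction.
Variable A : {measure set T -> \bar R}.
Hypothesis Ai : exp_integrable A.

(** Fubini needs a sigma-finite measure, and exponential moments control A only
on [0, +oo[. *)
Lemma half_line_restriction :
  exists nu : {sigma_finite_measure set T -> \bar R}, forall g : R -> R,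
    (\int[nu]_y (\1_Rp y * g y)%:E = \int[A]_(y in Rp) (g y)%:E)%E.
Proof.
have mRp : measurable Rp by exact: measurable_itv.
have sf : sigma_finite setT (mrestr A mRp).
  exists (fun n => `]-oo, n%:R]%classic).
    apply/seteqP; split => // x _.
    exists (Num.truncn `|x|).+1 => //=; rewrite in_itv/=.
    by rewrite (le_trans (ler_norm _))// ltW// truncnS_gt.
  move=> n; split; first exact: measurable_itv.
  rewrite /mrestr (_ : _ `&` _ = `[0, n%:R]%classic).
    exact: exp_integrable_itv_lty.
  apply/seteqP; split => x /=; rewrite !in_itv/= ?andbT.
    by move=> [-> ->].
  by move=> /andP[-> ->].
pose nu : {sigma_finite_measure set T -> \bar R} :=
  HB.pack (mrestr A mRp) (Measure_isSigmaFinite.Build _ _ _ _ sf).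
exists nu => g.
transitivity (\int[nu]_(y in Rp) (g y)%:E)%E.
  rewrite [RHS]integral_mkcond; apply: eq_integral => y _.
  by rewrite patchE indicE; case: ifP => _; rewrite ?mul1r ?mul0r.
apply: eq_measure_integral => S mS SR.
by rewrite /nu/= /mrestr setIidl.
Qed.

Variable q : R -> R.
Hypothesis iq : exp_density q.

Let q0 : T -> R := q \_ Rp.

Let mq0 : measurable_fun setT q0.
Proof.
apply/measurable_restrict => //; rewrite setTI; exact: exp_density_measurable.
Qed.

Let ind (x : T) : R := \1_Rp x.

Let mI : measurable_fun setT ind. Proof. exact: measurable_indic. Qed.

Section TestFunction.
Variables (phi : T -> R) (C a : R).
Hypotheses (mphi : measurable_fun setT phi) (a0 : 0 < a).
Hypothesis phiC : forall x, 0 <= x -> `|phi x| <= C * expR (- (x * a)).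
Variable nu : {sigma_finite_measure set T -> \bar R}.
Hypothesis nuE : forall g : R -> R,
    (\int[nu]_y (ind y * g y)%:E = \int[A]_(y in Rp) (g y)%:E)%E.

(* The same integrand before and after the change of variable x = u + y; G is a
   product of two integrable functions that dominates F2. *)
Let F2 (w : T * T) : \bar R := (ind w.2 * (phi (w.1 + w.2) * q0 w.1))%:E.
Let F1 (w : T * T) : \bar R := (ind w.2 * (phi w.1 * q0 (w.1 - w.2)))%:E.
Let G (w : T * T) : \bar R :=
  ((ind w.2 * (C * expR (- (w.2 * a)))) * (q0 w.1 * expR (- (w.1 * a))))%:E.

Let mF2 : measurable_fun setT F2.
Proof.
apply/measurable_EFinP/measurable_funM; first exact: measurableT_comp.
apply: measurable_funM; last exact: measurableT_comp.
by apply: measurableT_comp => //; exact: measurable_funD.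
Qed.

Let mF1 : measurable_fun setT F1.
Proof.
apply/measurable_EFinP/measurable_funM; first exact: measurableT_comp.
apply: measurable_funM; first exact: measurableT_comp.
by apply: measurableT_comp => //; exact: measurable_funB.
Qed.

Let mG : measurable_fun setT G.
Proof.
have me : measurable_fun setT (fun x : T => expR (- (x * a))).
  exact: measurable_expN.
apply/measurable_EFinP/measurable_funM.
  apply: measurable_funM; first exact: measurableT_comp.
  apply: measurable_funM => //; exact: measurableT_comp me measurable_snd.
apply: measurable_funM; first exact: measurableT_comp.
exact: measurableT_comp me measurable_fst.
Qed.

Let qe_integrable :
  leb.-integrable setT (fun u : T => (q0 u * expR (- (u * a)))%:E).
Proof.
have /integrable_mkcond := iq a0; move/(_ (measurable_itv _)).
apply: eq_integrable => // u _; rewrite /q0 !patchE.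
by case: ifP => _; rewrite /= ?mul0r.
Qed.

Let G_integrable : (leb \x nu)%E.-integrable setT G.
Proof.
apply/(integrable21ltyP _ _ mG).
pose K := \int[leb]_u `|q0 u * expR (- (u * a))|.
have KE : (\int[leb]_u `|q0 u * expR (- (u * a))|%:E)%E = K%:E.
  rewrite /K /Rintegral fineK//.
  by apply: integrable_fin_num => //; exact: integrable_norm qe_integrable.
have C0 : 0 <= C.
  have := phiC (lexx 0); rewrite mul0r oppr0 expR0 mulr1.
  exact: le_trans (normr_ge0 _).
have -> : (fun y => \int[leb]_u `|G (u, y)|)%E =
    fun y : T => (ind y * (C * K * expR (- (y * a))))%:E.
  apply/funext => y; rewrite /G/=.
  under eq_integral do rewrite normrM EFinM.
  rewrite ge0_integralZl//; last first.
    apply/measurable_EFinP; apply: measurableT_comp => //.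
    by apply: measurable_funM => //; exact: measurable_expN.
  rewrite KE -EFinM ger0_norm; last first.
    by rewrite mulr_ge0 ?mulr_ge0 ?expR_ge0// /ind indicE.
  by congr EFin; ring.
rewrite nuE.
have mRp : measurable Rp by exact: measurable_itv.
have Aa : A.-integrable Rp (fun x : R => (expR (- (x * a)))%:E) by exact: Ai.
have /integrableP[_] := integrableZl mRp (C * K) Aa.
have K0 : 0 <= K by apply: Rintegral_ge0.
congr (_ < _)%E; apply: eq_integral => y _ /=.
by rewrite ger0_norm// !mulr_ge0// expR_ge0.
Qed.

Let F2_integrable : (leb \x nu)%E.-integrable setT F2.
Proof.
apply: le_integrable G_integrable => // -[u y] _ /=; rewrite lee_fin /F2/=.
rewrite !normrM /ind indicE; have [/set_mem/=|_] := boolP (y \in Rp); last first.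
  by rewrite !normr0 !mul0r.
rewrite in_itv/= andbT => y0; rewrite normr1 !mul1r /q0 patchE.
case: ifPn => [/set_mem/=|_]; last by rewrite normr0 mul0r !mulr0.
rewrite in_itv/= andbT => u0.
rewrite (mulrC `|q u|) mulrA ler_wpM2r//.
apply: (le_trans (phiC (addr_ge0 u0 y0))).
rewrite -!normrM; apply: le_trans (ler_norm _).
by rewrite -mulrA -expRD (addrC (- (y * a))) -opprD mulrDl.
Qed.

Let F12 y : (\int[leb]_x F1 (x, y) = \int[leb]_u F2 (u, y))%E.
Proof.
rewrite -(integral_translation y (f := fun x => F1 (x, y))).
  by apply: eq_integral => u _; rewrite /F1 /F2/= addrK.
exact: measurableT_comp mF1 (measurable_pair2 y).
Qed.

Let F1_integrable : (leb \x nu)%E.-integrable setT F1.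
Proof.
apply/(integrable21ltyP _ _ mF1).
have /(integrable21ltyP _ _ mF2) := F2_integrable.
congr (_ < _)%E; apply: eq_integral => y _.
rewrite -(integral_translation y (f := fun x => `|F1 (x, y)|%E)).
  by apply: eq_integral => u _; rewrite /F1 /F2/= addrK.
apply: measurableT_comp => //.
exact: measurableT_comp mF1 (measurable_pair2 y).
Qed.

(** Fubini, the translation x = u + y for fixed y, and Fubini again. *)
Lemma convolution_fubini :
  [/\ leb.-integrable setT
        (fun x => \int[A]_(y in Rp) (phi x * q0 (x - y))%:E)%E,
      {ae leb, forall x, A.-integrable Rp
        (fun y => (phi x * q0 (x - y))%:E)},
      leb.-integrable setT
        (fun u => \int[A]_(y in Rp) (phi (u + y) * q0 u)%:E)%E
    & (\int[leb]_x \int[A]_(y in Rp) (phi x * q0 (x - y))%:E =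
      \int[leb]_u \int[A]_(y in Rp) (phi (u + y) * q0 u)%:E)%E].
Proof.
split.
- have := integrable_fubini_F F1_integrable.
  by apply: eq_integrable => // x _; rewrite /fubini_F/= nuE.
- have := ae_integrable1 F1_integrable.
  apply: filterS => x /integrableP[_]; rewrite /F1/= => xoo.
  have mx : measurable_fun setT (fun y : T => phi x * q0 (x - y)).
    apply: measurable_funM; first exact: measurable_cst.
    by apply: measurableT_comp => //; exact: measurable_funB.
  apply/integrableP; split; first exact/measurable_EFinP/measurable_funTS.
  apply: le_lt_trans xoo; rewrite -(nuE (fun y => `|phi x * q0 (x - y)|)).
  rewrite le_eqVlt; apply/orP; left; apply/eqP; apply: eq_integral => y _.
  have I0 : 0 <= ind y by rewrite /ind indicE.
  by rewrite -[in LHS](ger0_norm I0) -normrM.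
- have := integrable_fubini_F F2_integrable.
  by apply: eq_integrable => // u _; rewrite /fubini_F/F2/= nuE.
- transitivity (\int[leb]_x \int[nu]_y F1 (x, y))%E.
    by apply: eq_integral => x _; rewrite /F1/= nuE.
  rewrite (Fubini F1_integrable).
  under eq_integral do rewrite F12.
  rewrite -(Fubini F2_integrable).
  by apply: eq_integral => x _; rewrite /F2/= nuE.
Qed.

End TestFunction.

Let expR_bound (b : R) : forall x : R, 0 <= x ->
  `|expR (- (x * b))| <= 1 * expR (- (x * b)).
Proof. by move=> x _; rewrite mul1r ger0_norm ?expR_ge0. Qed.

(** The convolution integral may diverge on a null set; the second property
identifies its value wherever it converges.  The test functions phi cover both
the exponentials and the indicators of bounded intervals. *)
Lemma convolution_density : exists p : R -> R,
  [/\ exp_density p,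
      forall x, A.-integrable Rp (fun y => ((q \_ Rp) (x - y))%:E) ->
        p x = \int[A]_(y in Rp) (q \_ Rp) (x - y)
    & forall (phi : T -> R) C a, measurable_fun setT phi -> 0 < a ->
        (forall x, 0 <= x -> `|phi x| <= C * expR (- (x * a))) ->
        leb.-integrable Rp
          (EFin \o fun u => q u * \int[A]_(y in Rp) phi (u + y)) /\
        \int[leb]_(x in Rp) (phi x * p x) =
        \int[leb]_(u in Rp) (q u * \int[A]_(y in Rp) phi (u + y))].
Proof.
have mRp : measurable Rp by exact: measurable_itv.
have [nu nuE] := half_line_restriction.
have me b : measurable_fun setT (fun x : T => expR (- (x * b))).
  exact: measurable_expN.
(* The factors exp(x) and exp(-x) cancel; inside the integral exp(-x) is the
   test function from which Fubini gives the measurability of p. *)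
pose p (x : T) := expR (- (x * (-1))) *
  fine (\int[A]_(y in Rp) (expR (- (x * 1)) * q0 (x - y))%:E)%E.
have [T1 T2 _ _] := convolution_fubini (me 1) ltr01 (expR_bound 1) nuE.
have mp : measurable_fun setT p.
  apply: measurable_funM => //.
  by apply: measurableT_comp => //; exact: measurable_int T1.
have qint : {ae leb, forall x, A.-integrable Rp (fun y => (q0 (x - y))%:E)}.
  apply: filterS T2 => x xi.
  apply: eq_integrable (integrableZl mRp (expR (- (x * (-1)))) xi) => // y _ /=.
  by rewrite -EFinM mulrA -expRD mulrN opprK mulr1 subrr expR0 mul1r.
have pE x : A.-integrable Rp (fun y => (q0 (x - y))%:E) ->
    (p x)%:E = (\int[A]_(y in Rp) (q0 (x - y))%:E)%E.
  move=> xi; rewrite /p; under eq_integral do rewrite EFinM.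
  rewrite integralZl// fineM//; last exact: integrable_fin_num xi.
  rewrite mulrA -expRD mulrN opprK mulr1 subrr expR0 mul1r fineK//.
  exact: integrable_fin_num xi.
have p0 x : x < 0 -> p x = 0.
  move=> x0; rewrite /p integral0_eq ?mulr0// => y /=; rewrite in_itv/= andbT => y0.
  rewrite /q0 patchE memNset ?mulr0//= in_itv/= andbT.
  by apply/negP; rewrite -ltNge subr_lt0 (lt_le_trans x0).
have aep (phi : T -> R) : ae_eq leb setT
    (fun x => \int[A]_(y in Rp) (phi x * q0 (x - y))%:E)%E
    (fun x => (phi x * p x)%:E).
  have aeF := ae_filter_ringOfSetsType leb.
  apply: filterS qint => x xi _; rewrite EFinM pE//.
  by under eq_integral do rewrite EFinM; rewrite integralZl.
exists p; split.
- move=> a a0.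
  have [S1 _ _ _] := convolution_fubini (me a) a0 (expR_bound a) nuE.
  have mep : measurable_fun setT (fun x : T => (expR (- (x * a)) * p x)%:E).
    by apply/measurable_EFinP/measurable_funM.
  have : leb.-integrable setT (fun x : T => (expR (- (x * a)) * p x)%:E).
    apply/integrableP; split => //.
    have /integrableP[mS] := S1; congr (_ < _)%E.
    apply: ae_eq_integral => //; do ?exact: measurableT_comp.
    have aeF := ae_filter_ringOfSetsType leb.
    by apply: filterS (aep (fun x => expR (- (x * a)))) => x /(_ I) ->.
  move/(integrableS measurableT mRp (@subsetT _ _)).
  by apply: eq_integrable => // x _; rewrite /= mulrC.
- by move=> x xi; rewrite /Rintegral -pE.
move=> phi C a mphi a0 phiC.
have [S1 _ S2 S3] := convolution_fubini mphi a0 phiC nuE.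
have inner u : (\int[A]_(y in Rp) (phi (u + y) * q0 u)%:E =
    ((fun u => q u * \int[A]_(y in Rp) phi (u + y)) \_ Rp u)%:E)%E.
  rewrite /q0 !patchE; case: ifPn => [|_]; last first.
    by under eq_integral do rewrite mulr0; rewrite integral0.
  rewrite inE/= in_itv/= andbT => u0.
  have phiu : A.-integrable Rp (fun y => (phi (u + y))%:E).
    apply: le_integrable (integrableZl mRp C (Ai a0)) => //.
      apply/measurable_EFinP; apply: measurableT_comp => //.
      exact: measurable_funD.
    move=> y /=; rewrite in_itv/= andbT => y0; rewrite lee_fin.
    have C0 : 0 <= C.
      have := phiC _ (lexx 0); rewrite mul0r oppr0 expR0 mulr1.
      exact: le_trans (normr_ge0 _).
    apply: (le_trans (phiC _ (addr_ge0 u0 y0))).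
    apply: le_trans (ler_norm _); rewrite ler_wpM2l// ler_expR lerN2.
    by rewrite ler_wpM2r ?(ltW a0)// lerDr.
  under eq_integral do rewrite mulrC EFinM.
  by rewrite integralZl// EFinM fineK//; exact: integrable_fin_num.
split.
  apply/integrable_mkcond => //; apply: eq_integrable S2 => // u _.
  by rewrite inner restrict_EFin.
transitivity (\int[leb]_x (phi x * p x)).
  rewrite Rintegral_mkcond; apply: eq_Rintegral => x _; rewrite patchE.
  case: ifPn => // /negP; rewrite inE/= in_itv/= andbT => /negP.
  by rewrite -ltNge => /p0 ->; rewrite mulr0.
rewrite [RHS]Rintegral_mkcond /Rintegral; congr fine.
transitivity (\int[leb]_x \int[A]_(y in Rp) (phi x * q0 (x - y))%:E)%E.
  apply: ae_eq_integral => //; last exact: ae_eq_sym.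
  - by apply/measurable_EFinP/measurable_funM.
  - exact: measurable_int S1.
by rewrite S3; apply: eq_integral => u _; rewrite inner.
Qed.

End Restriction.

End Convolution.

(** * Functions with a density and the map m *)

Section Algebra.
Context {R : realType}.
Local Notation leb := (@lebesgue_measure R).
Local Notation T := (measurableTypeR R).
Local Notation Rp := (`[0%R, +oo[%classic : set (measurableTypeR R)).
Implicit Types (mu nu : real_radon R) (f g : {posnum R} -> R) (q p r : R -> R).

Lemma exp_moments_integrable mu : exp_moments mu ->
  exp_integrable (mpos mu) /\ exp_integrable (mneg mu).
Proof.
move=> mm.
have h (a : R) : 0 < a ->
    (\int[mpos mu]_(x in Rp) (expR (- (x * a)))%:E +
     \int[mneg mu]_(x in Rp) (expR (- (x * a)))%:E < +oo)%E.
  move=> a0; have := mm a a0.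
  rewrite /tvar; under eq_integral do rewrite mulrC.
  rewrite ge0_integral_measure_add//.
  by apply/measurable_EFinP; exact: measurable_expN.
have i0 (m : {measure set T -> \bar R}) (a : R) :
    (0 <= \int[m]_(x in Rp) (expR (- (x * a)))%:E)%E.
  by apply: integral_ge0 => x _; rewrite lee_fin expR_ge0.
have e (m : {measure set T -> \bar R}) (a : R) :
    (\int[m]_(x in Rp) (expR (- (x * a)))%:E < +oo)%E ->
    m.-integrable Rp (fun x : R => (expR (- (x * a)))%:E).
  move=> moo; apply/integrableP; split.
    by apply/measurable_EFinP; exact: measurable_expN.
  move: moo; congr (_ < _)%E; apply: eq_integral => x _.
  by rewrite /= ger0_norm ?expR_ge0.
split=> a a0; apply: e; apply: le_lt_trans (h a a0).
  by rewrite leeDl.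
by rewrite leeDr.
Qed.

Lemma exp_integrable_add (A B : {measure set T -> \bar R}) :
  exp_integrable A -> exp_integrable B -> exp_integrable (measure_add A B) /\
  forall z, 0 < z -> laplace_measure (measure_add A B) z =
    laplace_measure A z + laplace_measure B z.
Proof.
move=> Ai Bi.
have mz z : measurable_fun Rp (fun x : T => (expR (- (x * z)))%:E).
  by apply/measurable_EFinP; exact: measurable_expN.
have E z : (\int[measure_add A B]_(x in Rp) (expR (- (x * z)))%:E =
    \int[A]_(x in Rp) (expR (- (x * z)))%:E +
    \int[B]_(x in Rp) (expR (- (x * z)))%:E)%E.
  by rewrite ge0_integral_measure_add.
split=> [a a0|z z0].
  apply/integrableP; split => //.
  under eq_integral do rewrite /= ger0_norm ?expR_ge0//.
  rewrite E lte_add_pinfty// ltey_eq.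
    by rewrite (integrable_fin_num _ (Ai a a0)).
  by rewrite (integrable_fin_num _ (Bi a a0)).
rewrite /laplace_measure/Rintegral E fineD//.
- exact: integrable_fin_num (Ai z z0).
- exact: integrable_fin_num (Bi z z0).
Qed.

Lemma laplaceE mu (z : {posnum R}) :
  laplace mu z =
  laplace_measure (mpos mu) z%:num - laplace_measure (mneg mu) z%:num.
Proof. by []. Qed.

(** Both Jordan decompositions having the same transform, the positive measures
mpos mu + mneg nu and mpos nu + mneg mu have the same transform too. *)
Lemma represents_cumul mu nu f :
  represents mu f -> represents nu f -> cumul mu = cumul nu.
Proof.
move=> [/exp_moments_integrable[mp mn] fmu] [/exp_moments_integrable[np nn] fnu].
have [i1 e1] := exp_integrable_add mp nn.
have [i2 e2] := exp_integrable_add np mn.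
apply/funext => x; rewrite /cumul /radon_val; apply/eqP.
rewrite subr_eq addrAC eq_sym subr_eq; apply/eqP.
have fin (A : {measure set T -> \bar R}) : exp_integrable A ->
    A `[0, x%:num]%classic \is a fin_num.
  by move=> Ai; rewrite ge0_fin_numE// exp_integrable_itv_lty.
have := laplace_measure_inj i1 i2 _ (ge0 x).
have mE (C D : {measure set T -> \bar R}) S :
    (measure_add C D : {measure set T -> \bar R}) S = (C S + D S)%E.
  exact: measure_addE.
rewrite !mE !fineD ?fin// => -> // z z0.
rewrite e1// e2//; have := congr1 (fun h => h (PosNum z0)) (etrans (esym fmu) fnu).
by rewrite !laplaceE/= => h; lra.
Qed.

Lemma mikE mu f : represents mu f -> mik f = cumul mu.
Proof.
move=> muf; rewrite /mik; case: xgetP => [F ? [nu [nuf ->]]|/(_ (cumul mu))].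
  exact: represents_cumul nuf muf.
by case; exists mu.
Qed.

(** f is the transform of q dx plus c times the unit mass at 0. *)
Definition has_density q c f :=
  exp_density q /\ f = (fun z => laplace_density q z%:num + c).

Lemma has_density_represents q c f : has_density q c f ->
  exists mu, [/\ represents mu f,
    forall x, cumul mu x = c + \int[leb]_(u in `[0, x%:num]) q u
    & c = 0 -> tvar mu `<< leb].
Proof.
move=> [iq ->]; have [mu [mm lmu cmu dmu]] := radon_of_density c iq.
by exists mu; split => //; split => //; apply/funext => z; rewrite lmu.
Qed.

Lemma JidealP f : Jideal f <-> exists q, has_density q 0 f.
Proof.
split.
  move=> [mu [[/exp_moments_integrable[ip inn] ->] /null_content_dominatesP muleb]].
  have dom N : measurable N -> leb N = 0%E ->
      mpos mu N = 0%E /\ mneg mu N = 0%E.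
    move=> mN N0; have := muleb N mN N0.
    move=> /(etrans (esym (measure_addE _ _ _))) /eqP.
    by rewrite padde_eq0// => /andP[/eqP-> /eqP->].
  have [q1 [iq1 l1]] := dominated_has_density ip
    ((null_content_dominatesP _ _).2 (fun N mN N0 => (dom N mN N0).1)).
  have [q2 [iq2 l2]] := dominated_has_density inn
    ((null_content_dominatesP _ _).2 (fun N mN N0 => (dom N mN N0).2)).
  have [i e] := exp_densityB iq1 iq2.
  exists (fun x => q1 x - q2 x); split => //; apply/funext => z.
  by rewrite laplaceE l1// l2// e// addr0.
by move=> [q /has_density_represents[mu [muf _ d]]]; exists mu; split => //; exact: d.
Qed.

Lemma Binf0P f : Binf0 f <-> exists q c, has_density q c f.
Proof.
split.
  move=> [g [c [/JidealP[q [iq ->]] ->]]]; exists q, c; split => //.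
  apply/funext => z.
  by rewrite -[LHS]/(laplace_density q z%:num + 0 + c) addr0.
move=> [q [c [iq ->]]].
exists (fun z => laplace_density q z%:num + 0), c; split.
  by apply/JidealP; exists q.
apply/funext => z.
by rewrite -[RHS]/(laplace_density q z%:num + 0 + c) addr0.
Qed.

Lemma mik_density q c f : has_density q c f ->
  mik f = (fun x => c + \int[leb]_(u in `[0, x%:num]) q u).
Proof.
move=> /has_density_represents[mu [muf cmu _]].
by rewrite (mikE muf); apply/funext.
Qed.

Lemma Binf0_Binf f : Binf0 f -> Binf f.
Proof.
by move=> /Binf0P[q [c /has_density_represents[mu [muf _ _]]]]; exists mu.
Qed.

Lemma density_integral_unique q r : exp_density q -> exp_density r ->
  (forall z, 0 < z -> laplace_density q z = laplace_density r z) ->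
  forall x, 0 <= x ->
    \int[leb]_(u in `[0, x]) q u = \int[leb]_(u in `[0, x]) r u.
Proof.
move=> iq ir qr x x0.
pose f (z : {posnum R}) := laplace_density q z%:num + 0.
have fq : has_density q 0 f by [].
have fr : has_density r 0 f.
  by split => //; apply/funext => z; rewrite /f qr.
have := congr1 (fun F => F (NngNum x0))
  (etrans (esym (mik_density fq)) (mik_density fr)).
by rewrite /= !add0r.
Qed.

End Algebra.

(** * Products of transforms *)

Section RadonConvolution.
Context {R : realType}.
Local Notation leb := (@lebesgue_measure R).
Local Notation T := (measurableTypeR R).
Local Notation Rp := (`[0%R, +oo[%classic : set (measurableTypeR R)).
Implicit Types (mu nu : real_radon R) (f g : {posnum R} -> R) (q p r : R -> R).

(** The test functions are exp(- x z) for the transform, and the indicator of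
[0, x] for the integral over [0, x]. *)
Lemma measure_convolution (A : {measure set T -> \bar R}) q :
  exp_integrable A -> exp_density q -> exists p,
  [/\ exp_density p,
      forall x, A.-integrable Rp (fun y => ((q \_ Rp) (x - y))%:E) ->
        p x = \int[A]_(y in Rp) (q \_ Rp) (x - y),
      forall z, 0 < z ->
        laplace_density p z = laplace_measure A z * laplace_density q z
    & forall x, leb.-integrable `[0, x]
        (EFin \o fun u => q u * fine (A `[0, x - u]%classic)) /\
      \int[leb]_(u in `[0, x]) p u =
        \int[leb]_(u in `[0, x]) (q u * fine (A `[0, x - u]%classic))].
Proof.
move=> Ai iq; have [p [ip pE pI]] := convolution_density Ai iq.
exists p; split => //.
- move=> z z0.
  have [] := pI (fun x => expR (- (x * z))) 1 z (@measurable_expN R setT z) z0.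
    by move=> x _; rewrite mul1r ger0_norm ?expR_ge0.
  move=> _ E; rewrite /laplace_density.
  under eq_Rintegral do rewrite mulrC.
  rewrite E -RintegralZl//; last exact: iq.
  apply: eq_Rintegral => u _ /=; rewrite mulrCA; congr (_ * _).
  under eq_Rintegral do rewrite mulrDl opprD expRD.
  rewrite RintegralZl//; last exact: Ai.
  by rewrite mulrC.
move=> x.
pose phi : T -> R := \1_(`[0, x]%classic).
have [] := pI phi (expR x) 1 _ ltr01.
- exact: measurable_indic.
- move=> y y0; rewrite /phi indicE mulr1.
  have [/set_mem/=|_] := boolP (y \in _).
    rewrite in_itv/= => /andP[_ yx]; rewrite normr1 -expRD.
    by rewrite -expR0 ler_expR subr_ge0.
  by rewrite normr0 mulr_ge0 ?expR_ge0.
have sub : `[0, x] `<=` Rp by apply: subset_itvl.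
have inner u : 0 <= u -> \int[A]_(y in Rp) phi (u + y) =
    fine (A `[0, x - u]%classic).
  move=> u0; rewrite /Rintegral.
  rewrite (eq_integral (fun y : T => (\1_(`[0, x - u]%classic : set T) y)%:E)).
    rewrite integral_indic// setIidl//.
    by apply: subset_itvl.
  move=> y; rewrite inE/= in_itv/= andbT => y0; congr EFin.
  rewrite /phi !indicE; congr (nat_of_bool _)%:R.
  by apply/idP/idP; rewrite !inE/= !in_itv/= y0 addr_ge0//= lerBrDl.
rewrite Rintegral_indic_itv => pi ->; split.
  have : leb.-integrable `[0, x]
      (EFin \o fun u => q u * \int[A]_(y in Rp) phi (u + y)).
    exact: integrableS pi.
  apply: eq_integrable => // u; rewrite inE/= in_itv/= => /andP[u0 _].
  by rewrite inner.
rewrite -(Rintegral_indic_itv x (fun u => q u * fine (A `[0, x - u]%classic))).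
apply: eq_Rintegral => u; rewrite inE/= in_itv/= andbT => u0.
rewrite inner// indicE; have [_|/negP ux] := boolP (u \in _); first by rewrite mul1r.
rewrite mul0r (_ : `[0, x - u]%classic = set0) ?measure0/= ?mulr0//.
apply/seteqP; split => // y /=; rewrite in_itv/= => /andP[y0 yx].
apply: ux; rewrite inE/= in_itv/= u0/=.
by rewrite -subr_ge0 (le_trans y0).
Qed.

Lemma radon_convolution mu q : exp_moments mu -> exp_density q -> exists p,
  [/\ exp_density p,
      forall x,
        (mpos mu).-integrable Rp (fun y => ((q \_ Rp) (x - y))%:E) ->
        (mneg mu).-integrable Rp (fun y => ((q \_ Rp) (x - y))%:E) ->
        p x = \int[mpos mu]_(y in Rp) (q \_ Rp) (x - y) -
              \int[mneg mu]_(y in Rp) (q \_ Rp) (x - y),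
      forall z : {posnum R},
        laplace_density p z%:num = laplace mu z * laplace_density q z%:num
    & forall x, \int[leb]_(u in `[0, x]) p u =
        \int[leb]_(u in `[0, x]) (q u * radon_val mu `[0, x - u])].
Proof.
move=> /exp_moments_integrable[mp mn] iq.
have [p1 [ip1 E1 L1 I1]] := measure_convolution mp iq.
have [p2 [ip2 E2 L2 I2]] := measure_convolution mn iq.
have [ip L] := exp_densityB ip1 ip2.
exists (fun x => p1 x - p2 x); split => //.
- by move=> x x1 x2; rewrite E1// E2.
- by move=> z; rewrite L// L1// L2// laplaceE mulrBl.
move=> x; have [i1 e1] := I1 x; have [i2 e2] := I2 x.
rewrite RintegralB//; [|exact: exp_density_integrable_itv..].
rewrite e1 e2 -RintegralB//; apply: eq_Rintegral => u _.
by rewrite /radon_val mulrBr.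
Qed.

Lemma exp_density1 : exp_density (cst 1 : R -> R) /\
  forall z : R, 0 < z -> laplace_density (cst 1) z = z^-1.
Proof.
have E (z : R) : 0 < z ->
    (\int[leb]_(x in Rp) (z * expR (- (x * z)))%:E = 1)%E.
  move=> z0; rewrite -(integral_exponential_pdf z0) integral_mkcond.
  apply: eq_integral => x _; rewrite /exponential_pdf !patchE; case: ifP => // _.
  by rewrite mulNr (mulrC z x).
have i1 : exp_density (cst 1 : R -> R).
  apply: exp_densityP => // a a0.
  have : (a%:E * \int[leb]_(x in Rp) (expR (- (x * a)))%:E < +oo)%E.
    rewrite -ge0_integralZl//.
    - under eq_integral do rewrite -EFinM.
      by rewrite E// ltry.
    - by apply/measurable_EFinP; exact: measurable_expN.
    - by rewrite lee_fin ltW.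
  under [in X in _ -> X]eq_integral do rewrite normr1 mul1r.
  move=> h; rewrite ltey; apply/eqP => oo; move: h.
  by rewrite oo mulry gtr0_sg// mul1e.
split => // z z0; apply: (mulfI (lt0r_neq0 z0)).
rewrite divff ?lt0r_neq0// /laplace_density -RintegralZl//; last exact: i1.
by under eq_Rintegral do rewrite mul1r; rewrite /Rintegral E.
Qed.

Lemma eq_exp_density q r : (forall x, 0 <= x -> q x = r x) ->
  exp_density q -> exp_density r /\
  forall z, laplace_density r z = laplace_density q z.
Proof.
move=> qr iq; split=> [a a0|z].
  apply: eq_integrable (iq a a0) => // x; rewrite inE/= in_itv/= andbT => x0.
  by rewrite qr.
by apply: eq_Rintegral => x; rewrite inE/= in_itv/= andbT => x0; rewrite qr.
Qed.

(** Convolving mu with the constant density 1 gives int_{y <= x} dmu(y), and the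
transform of the density 1 is 1/z. *)
Lemma cumul_has_density mu f : represents mu f ->
  has_density (fun x => radon_val mu `[0, x]) 0 (fun z => f z / z%:num).
Proof.
move=> [mm ->]; have [i1 L1] := exp_density1.
have [p [ip pE L _]] := radon_convolution mm i1.
have [mp mn] := exp_moments_integrable mm.
have ind x y : 0 <= y -> ((cst 1 : R -> R) \_ Rp) (x - y) =
    \1_(`[0, x]%classic : set T) y.
  move=> y0; rewrite patchE indicE.
  have -> : (x - y \in Rp) = (y \in `[0, x]%classic).
    by apply/idP/idP; rewrite !inE/= !in_itv/= y0 andbT subr_ge0.
  by case: ifP.
have int (A : {measure set T -> \bar R}) x : exp_integrable A ->
    A.-integrable Rp (fun y => (((cst 1 : R -> R) \_ Rp) (x - y))%:E) /\
    \int[A]_(y in Rp) ((cst 1 : R -> R) \_ Rp) (x - y) =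
      fine (A `[0, x]%classic).
  move=> Ai.
  have E : (\int[A]_(y in Rp) (\1_(`[0%R, x]%classic : set T) y)%:E =
      A `[0%R, x]%classic)%E.
    by rewrite integral_indic// setIidl//; apply: subset_itvl.
  have indin : {in Rp, (fun y : T => (\1_(`[0, x]%classic : set T) y)%:E) =1
      (fun y => (((cst 1 : R -> R) \_ Rp) (x - y))%:E)}.
    by move=> y; rewrite inE/= in_itv/= andbT => y0; rewrite ind.
  split; last by rewrite /Rintegral -E; congr fine; apply: eq_integral => y /indin.
  apply: (eq_integrable _ _ _ indin) => //; apply/integrableP; split.
    by apply/measurable_EFinP; exact: measurable_indic.
  under eq_integral do rewrite /= ger0_norm ?indicE//.
  by rewrite [X in (X < _)%E]E exp_integrable_itv_lty.
have [ir Lr] : exp_density (fun x => radon_val mu `[0, x]) /\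
    forall z, laplace_density (fun x => radon_val mu `[0, x]) z =
      laplace_density p z.
  apply: eq_exp_density ip => x x0.
  have [j1 e1] := int _ x mp; have [j2 e2] := int _ x mn.
  by rewrite pE// e1 e2.
split => //; apply/funext => z.
by rewrite Lr L L1// addr0.
Qed.

End RadonConvolution.

(** * The Duhamel product as a derivative *)

Section Duhamel.
Context {R : realType}.
Local Notation leb := (@lebesgue_measure R).
Local Notation Rp := (`[0%R, +oo[%classic : set (measurableTypeR R)).

Lemma half_line_dnbhs_proper (t : R) : 0 <= t ->
  ProperFilter (within [set s : R | 0 <= s] t^').
Proof.
move=> t0; apply: Build_ProperFilter_ex => P [e /= e0 Pe].
exists (t + e / 2); apply: (Pe (t + e / 2)) => /=.
- rewrite opprD addrA subrr sub0r normrN gtr0_norm ?divr_gt0//.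
  by rewrite ltr_pdivrMr// ltr_pMr// ltr1n.
- by rewrite gt_eqF// ltrDl divr_gt0.
- by rewrite addr_ge0// divr_ge0// ltW.
Qed.

(** The primitive is started at -1 so that every t >= 0, the point 0 included, is
interior and the fundamental theorem of calculus applies to it. *)
Lemma primitive_difference_quotient (E : R -> R) (t : R) :
  continuous E -> 0 <= t ->
  ((\int[leb]_(u in `[0, s]) E u - \int[leb]_(u in `[0, t]) E u) / (s - t)
    @[s --> within [set s | 0 <= s] t^']) --> E t.
Proof.
move=> cE t0.
pose K (s : R) := \int[leb]_(u in `[-1, s]) E u.
have iE (a b : R) : leb.-integrable `[a, b] (EFin \o E).
  apply: continuous_compact_integrable; first exact: segment_compact.
  exact: continuous_subspaceT.
have KE s : 0 <= s ->
    \int[leb]_(u in `[0, s]) E u = K s - \int[leb]_(u in `[-1, 0[) E u.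
  move=> s0; rewrite /K.
  rewrite (@itv_bndbnd_setU _ _ (BLeft (- 1)) (BLeft 0) (BRight s))
    ?bnd_simp ?lerN10//.
  rewrite Rintegral_setU//.
  - by rewrite addrAC subrr add0r.
  - by rewrite -itv_bndbnd_setU ?bnd_simp ?lerN10//; exact: iE.
  - apply/disj_setPS => y [/=]; rewrite !in_itv/= => /andP[_ y0] /andP[].
    by rewrite leNgt y0.
have [dK K'] : derivable K t 1 /\ derive1 K t = E t.
  apply: (@continuous_FTC1_closed _ _ _ _ (t + 1)) => //.
  - by rewrite ltrDl.
  - by rewrite (lt_le_trans _ t0)// ltrN10.
  - exact: cE.
have /cvgrPdist_lt lim0 : (h^-1 *: (K (h *: 1 + t) - K t)) @[h --> 0^'] --> E t.
  by rewrite -K' derive1E; exact: dK.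
apply/cvgrPdist_lt => e e0.
have [d /= d0 dP] := lim0 e e0.
exists d => //= s sd st s0; rewrite !KE// opprB addrA subrK.
have := dP (s - t); rewrite /= sub0r normrN distrC => /(_ sd).
rewrite subr_eq0 => /(_ st); rewrite /GRing.scale/= mulr1 subrK.
by rewrite mulrC.
Qed.

Lemma duhamel_primitive (F G : {nonneg R} -> R) (E : R -> R) : continuous E ->
  (forall s, 0 <= s -> Defs.conv F G s = \int[leb]_(u in `[0, s]) E u) ->
  duhamel F G = (fun t => E t%:num).
Proof.
move=> cE convE; apply/funext => t; rewrite /duhamel.
have P := half_line_dnbhs_proper (ge0 t).
apply: cvg_lim; first exact: Rhausdorff.
apply: (cvg_trans _ (primitive_difference_quotient cE (ge0 t))).
apply: near_eq_cvg; exists 1 => //= s _ _ s0.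
by rewrite !convE.
Qed.

Lemma density_primitive_continuous (q : R -> R) c : exp_density q ->
  continuous (fun t : R => c + \int[leb]_(u in `[0, `|t|]) q u).
Proof.
move=> iq.
pose q0 := q \_ Rp.
pose P s := \int[leb]_(u in `[-1, s]) q0 u.
have iq0 b : leb.-integrable `[-1, b] (EFin \o q0).
  pose D : set (measurableTypeR R) := `[0, b]%classic.
  have mD : measurable D by exact: measurable_itv.
  have i0 : leb.-integrable D (EFin \o q) by exact: exp_density_integrable_itv.
  have i1 := (integrable_mkcond _ mD).1 i0.
  have : leb.-integrable `[-1, b] ((EFin \o q) \_ D).
    by apply: (integrableS measurableT _ _ i1).
  apply: eq_integrable => // x; rewrite inE/= in_itv/= => /andP[x1 xb].
  rewrite /q0/= !patchE.
  have -> : (x \in D) = (x \in Rp).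
    by apply/idP/idP; rewrite /D !inE/= !in_itv/= xb ?andbT.
  by case: ifP.
have PE s : 0 <= s -> \int[leb]_(u in `[0, s]) q u = P s.
  move=> s0; rewrite /P Rintegral_mkcond [RHS]Rintegral_mkcond.
  apply: eq_Rintegral => x _; rewrite /q0 !patchE.
  have [xs|xs] := boolP (x \in `[0, s]%classic).
    move: xs; rewrite inE/= in_itv/= => /andP[x0 xs].
    rewrite !mem_set//= in_itv/= ?x0// xs andbT.
    by rewrite (le_trans _ x0)// lerN10.
  case: ifPn => // xs'; case: ifPn => // x0; move/negP: xs; case.
  by move: xs' x0; rewrite !inE/= !in_itv/= => /andP[_ ->] ; rewrite !andbT.
have cP s : 0 <= s -> {for s, continuous P}.
  move=> s0; apply: (@within_continuous_continuous _ _ _ (-1) (s + 1)).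
  - by lra.
  - apply: parameterized_integral_continuous => //.
    by lra.
  - by rewrite in_itv/=; lra.
move=> t; apply: cvgD; first exact: cvg_cst.
have H : {for t, continuous (P \o Num.norm)}.
  by apply: continuous_comp; [exact: norm_continuous|exact: cP].
suff E : (fun s : R => \int[leb]_(u in `[0, `|s|]) q u) = P \o Num.norm.
  by move: H; rewrite -E.
by apply/funext => s; rewrite /= PE.
Qed.

End Duhamel.

(** * The ring structure of B^+_oo,0 *)

Section RingStructure.
Context {R : realType}.
Local Notation leb := (@lebesgue_measure R).
Implicit Types (f g : {posnum R} -> R) (q r : R -> R).

Lemma has_densityD q c f r d g : has_density q c f -> has_density r d g ->
  has_density (fun x => q x + r x) (c + d) (f + g).
Proof.
move=> [iq ->] [ir ->]; have [i L] := exp_densityD iq ir.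
split => //; apply/funext => z; rewrite L//.
by rewrite -[LHS]/(_ + c + (_ + d)) addrACA.
Qed.

Lemma has_densityZ q c f k : has_density q c f ->
  has_density (fun x => k * q x) (k * c) (fun z => k * f z).
Proof.
move=> [iq ->]; have [i L] := exp_densityZ k iq.
by split => //; apply/funext => z; rewrite L// mulrDr.
Qed.

Lemma has_density_cst (c : R) : has_density (fun=> 0) c (cst c).
Proof.
have [i1 _] := @exp_density1 R; have [i L] := exp_densityZ 0 i1.
have E : (fun _ : R => 0 : R) = (fun x : R => 0 * cst 1 x).
  by apply/funext => x; rewrite mul0r.
by rewrite E; split => //; apply/funext => z; rewrite L// mul0r add0r.
Qed.

Lemma Binf_mul_density q f g : Binf f -> has_density q 0 g ->
  exists p, has_density p 0 (f * g).
Proof.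
move=> [mu [mm ->]] [iq ->].
have [p [ip _ L _]] := radon_convolution mm iq.
exists p; split => //; apply/funext => z.
by rewrite L addr0 -[LHS]/(_ * (_ + 0)) addr0.
Qed.

Lemma has_densityM q c f r d g : has_density q c f -> has_density r d g ->
  exists p, has_density p (c * d) (f * g).
Proof.
move=> hf hg.
have hf0 : has_density q 0 (fun z => f z - c).
  by split; [exact: hf.1|apply/funext => z; rewrite hf.2 addrK addr0].
have hg0 : has_density r 0 (fun z => g z - d).
  by split; [exact: hg.1|apply/funext => z; rewrite hg.2 addrK addr0].
have [mu [muf _ _]] := has_density_represents hf.
have [p hp] := Binf_mul_density (ex_intro _ mu muf) hg0.
have h := has_densityD hp (has_densityZ d hf).
rewrite add0r (mulrC d c) in h.
rewrite (_ : f * g = f * (fun z => g z - d) + (fun z => d * f z)); last first.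
  apply/funext => z; rewrite -[RHS]/(f z * (g z - d) + d * f z) -[LHS]/(f z * g z).
  by ring.
by eexists; exact: h.
Qed.

Lemma Binf0D f g : Binf0 f -> Binf0 g -> Binf0 (f + g).
Proof.
move=> /Binf0P[q [c hf]] /Binf0P[r [d hg]]; apply/Binf0P.
by do 2 eexists; exact: has_densityD hf hg.
Qed.

Lemma Binf0N f : Binf0 f -> Binf0 (- f).
Proof.
move=> /Binf0P[q [c hf]]; apply/Binf0P.
rewrite (_ : - f = (fun z => - 1 * f z)); last by apply/funext => z; rewrite mulN1r.
by do 2 eexists; exact: has_densityZ hf.
Qed.

Lemma Binf0M f g : Binf0 f -> Binf0 g -> Binf0 (f * g).
Proof.
move=> /Binf0P[q [c hf]] /Binf0P[r [d hg]]; apply/Binf0P.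
by have [p hp] := has_densityM hf hg; do 2 eexists; exact: hp.
Qed.

Lemma Binf0_cst (c : R) : Binf0 (cst c : {posnum R} -> R).
Proof. by apply/Binf0P; do 2 eexists; exact: has_density_cst. Qed.

Lemma mik_cst (c : R) : mik (cst c) = cst c :> ({nonneg R} -> R).
Proof.
rewrite (mik_density (has_density_cst c)); apply/funext => x.
by rewrite Rintegral_cst// mul0r addr0.
Qed.

Lemma mikD f g : Binf0 f -> Binf0 g -> mik (f + g) = mik f + mik g.
Proof.
move=> /Binf0P[q [c hf]] /Binf0P[r [d hg]].
rewrite (mik_density (has_densityD hf hg)) (mik_density hf) (mik_density hg).
apply/funext => x; rewrite RintegralD//.
- by rewrite addrACA.
- by apply: exp_density_integrable_itv; exact: hf.1.
- by apply: exp_density_integrable_itv; exact: hg.1.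
Qed.

Lemma mik_Mik f : Binf0 f -> Mik (mik f).
Proof.
move=> /Binf0P[q [c hf]]; exists q; split.
  by move=> b; apply: exp_density_integrable_itv; exact: hf.1.
move=> t; rewrite (mik_density hf); congr (_ + _).
by rewrite /= set_itv1 Rintegral_set1 addr0.
Qed.

(** f(z)/z is the transform of the cumulative function of the measure of f. *)
Lemma mik_inj f g : Binf f -> Binf g -> mik f = mik g -> f = g.
Proof.
move=> [mu muf] [nu nug]; rewrite (mikE muf) (mikE nug) => mn.
have [i1 e1] := cumul_has_density muf; have [i2 e2] := cumul_has_density nug.
have h x : 0 <= x -> radon_val mu `[0, x] = radon_val nu `[0, x].
  by move=> x0; have := congr1 (fun F => F (NngNum x0)) mn.
have [_ L] := eq_exp_density h i1.
apply/funext => z.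
have := congr1 (fun F => F z) e1; have := congr1 (fun F => F z) e2 => /=.
by rewrite -L => <- /mulIf; apply; rewrite invr_neq0.
Qed.

(** The measure of f g iota is computed in two ways: by convolving the measure of
g with the density m(f) of f iota, and as the measure with density m(f g).
Comparing the masses of [0, s] shows that the integral whose derivative is the
Duhamel product is a primitive of m(f g). *)
Lemma mikM f g : Binf0 f -> Binf0 g -> mik (f * g) = duhamel (mik f) (mik g).
Proof.
move=> f0 g0; have h0 := Binf0M f0 g0.
have [mu muf] := Binf0_Binf f0; have [nu nug] := Binf0_Binf g0.
have [la lah] := Binf0_Binf h0.
have [iF eF] := cumul_has_density muf; have [iH eH] := cumul_has_density lah.
have [p [ip _ Lp Ip]] := radon_convolution nug.1 iF.
have /Binf0P[q [c hq]] := h0.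
have HE x : 0 <= x -> radon_val la `[0, x] = c + \int[leb]_(u in `[0, `|x|]) q u.
  move=> x0; have := congr1 (fun F => F (NngNum x0))
    (etrans (esym (mikE lah)) (mik_density hq)).
  by rewrite /cumul/= ger0_norm.
rewrite (duhamel_primitive (@density_primitive_continuous _ q c hq.1)); last first.
  move=> s s0.
  transitivity (\int[leb]_(u in `[0, s]) p u).
    rewrite Ip; apply: eq_Rintegral => u; rewrite inE/= in_itv/= => /andP[u0 us].
    rewrite /ext0 (mikE muf) (mikE nug) /cumul/= !ger0_norm//.
    by rewrite subr_ge0.
  rewrite (density_integral_unique ip iH)//.
    by apply: eq_Rintegral => u; rewrite inE/= in_itv/= => /andP[u0 _]; exact: HE.
  move=> z z0; rewrite -[z]/((PosNum z0)%:num) Lp.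
  have <- := congr1 (fun F => F (PosNum z0)) nug.2.
  have := congr1 (fun F => F (PosNum z0)) eF; rewrite /= addr0 => <-.
  have := congr1 (fun F => F (PosNum z0)) eH; rewrite /= addr0 => <-.
  by rewrite -[(f * g) _]/(f _ * g _); ring.
by rewrite (mikE lah); apply/funext => x; rewrite /cumul HE.
Qed.

End RingStructure.

(** * Multiplication by iota and the extension to B^+_oo *)

Section Iota.
Context {R : realType}.
Implicit Types f g : {posnum R} -> R.

Definition iota_fun : {posnum R} -> R := fun z => z%:num^-1.

Lemma iota_density : has_density (cst 1) 0 iota_fun.
Proof.
have [i L] := @exp_density1 R.
by split => //; apply/funext => z; rewrite L// addr0.
Qed.

Lemma Binf0_iota : Binf0 iota_fun.
Proof. by apply/Binf0P; do 2 eexists; exact: iota_density. Qed.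

Lemma mik_iota : mik iota_fun = (fun x : {nonneg R} => x%:num).
Proof.
rewrite (mik_density iota_density); apply/funext => x.
rewrite Rintegral_cst//= lebesgue_measure_itv/= lte_fin add0r mul1r.
by case: ltP => [_|x0]; rewrite /= ?subr0//; apply/le_anti; rewrite x0 ge0.
Qed.

Lemma Binf0_mul_iota f : Binf f -> Binf0 (f * iota_fun).
Proof.
move=> Bf; have [p hp] := Binf_mul_density Bf iota_density.
by apply/Binf0P; do 2 eexists; exact: hp.
Qed.

Lemma mul_iota_inj f g : f * iota_fun = g * iota_fun -> f = g.
Proof.
move=> fg; apply/funext => z; have := congr1 (fun F => F z) fg.
rewrite -[(f * _) z]/(f z * z%:num^-1) -[(g * _) z]/(g z * z%:num^-1).
by move/mulIf; apply; rewrite invr_neq0.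
Qed.

End Iota.

Section Extension.
Context {R : realType} (K : fieldType) (j : ({nonneg R} -> R) -> K).
Hypothesis jfrac : Mik_fraction_field j.
Implicit Types f g : {posnum R} -> R.

Let jD f g : Binf0 f -> Binf0 g -> j (mik (f + g)) = j (mik f) + j (mik g).
Proof.
move=> f0 g0; rewrite mikD//.
by apply: (ring_hom_onD (Mik_frac_hom jfrac)); exact: mik_Mik.
Qed.

Let jM f g : Binf0 f -> Binf0 g -> j (mik (f * g)) = j (mik f) * j (mik g).
Proof.
move=> f0 g0; rewrite mikM//.
by apply: (ring_hom_onM (Mik_frac_hom jfrac)); exact: mik_Mik.
Qed.

Let jiota_neq0 : j (mik (@iota_fun R)) != 0.
Proof.
have j0 : j (mik (cst 0 : {posnum R} -> R)) = 0.
  apply: (addrI (j (mik (cst 0 : {posnum R} -> R)))).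
  rewrite addr0 -jD; [|exact: Binf0_cst..]; congr (j (mik _)).
  by apply/funext => z; rewrite -[LHS]/(0 + 0) addr0.
apply/eqP; rewrite -j0 => /(Mik_frac_inj jfrac (mik_Mik Binf0_iota)).
move=> /(_ (mik_Mik (Binf0_cst 0))); rewrite mik_iota mik_cst.
move=> /(congr1 (fun F => F (1%:nng : {nonneg R})))/= /eqP.
by rewrite oner_eq0.
Qed.

Definition mik_extension f : K := j (mik (f * iota_fun)) / j (mik (@iota_fun R)).

Lemma mik_extensionE f : Binf0 f -> mik_extension f = j (mik f).
Proof.
by move=> f0; rewrite /mik_extension jM ?mulfK//; exact: Binf0_iota.
Qed.

(** The case of a product reduces to [jM] on B^+_oo,0: f g iota lies in
B^+_oo,0 because g iota lies in the ideal J, and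
((f g) iota) iota = (f iota) (g iota). *)
Lemma mik_extension_hom : ring_hom_on (@Binf R) *%R 1 *%R 1 mik_extension.
Proof.
split.
- by rewrite /mik_extension mul1r divff.
- move=> f g Bf Bg; rewrite /mik_extension mulrDl jD ?mulrDl//;
    exact: Binf0_mul_iota.
- move=> f g Bf Bg; have fi := Binf0_mul_iota Bf; have gi := Binf0_mul_iota Bg.
  have fgi : Binf0 (f * g * iota_fun).
    have [q hq] := Binf_mul_density Bg iota_density.
    have [p hp] := Binf_mul_density Bf hq.
    by rewrite -mulrA; apply/Binf0P; do 2 eexists; exact: hp.
  have E : j (mik (f * g * iota_fun)) * j (mik (@iota_fun R)) =
      j (mik (f * iota_fun)) * j (mik (g * iota_fun)).
    rewrite -!jM//; last exact: Binf0_iota.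
    by congr (j (mik _)); rewrite mulrACA mulrA.
  by rewrite /mik_extension mulf_div -E -mulf_div divff// mulr1.
Qed.

Lemma mik_extensionZ (a : R) f : Binf f ->
  mik_extension (a *: f) = j (cst a) * mik_extension f.
Proof.
move=> Bf; rewrite /mik_extension mulrA -mik_cst -jM; first last.
- exact: Binf0_mul_iota.
- exact: Binf0_cst.
congr (j (mik _) / _); apply/funext => z.
by rewrite -[RHS]/(a * (f z * z%:num^-1)) mulrA.
Qed.

Lemma mik_extension_inj : injective_on (@Binf R) mik_extension.
Proof.
move=> f g Bf Bg /(mulIf _); rewrite invr_eq0 => /(_ jiota_neq0).
have fi := Binf0_mul_iota Bf; have gi := Binf0_mul_iota Bg.
move/(Mik_frac_inj jfrac (mik_Mik fi) (mik_Mik gi)).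
by move/(mik_inj (Binf0_Binf fi) (Binf0_Binf gi))/mul_iota_inj.
Qed.

(** psi f psi(iota) = psi(f iota), where iota and f iota lie in B^+_oo,0. *)
Lemma mik_extension_unique (psi : ({posnum R} -> R) -> K) :
  ring_hom_on (@Binf R) *%R 1 *%R 1 psi ->
  (forall f, Binf0 f -> psi f = j (mik f)) ->
  forall f, Binf f -> psi f = mik_extension f.
Proof.
move=> psih psi0 f Bf; apply: (mulIf jiota_neq0); rewrite mulfVK//.
rewrite -(psi0 _ Binf0_iota) -(psi0 _ (Binf0_mul_iota Bf)).
by rewrite (ring_hom_onM psih)//; exact: Binf0_Binf Binf0_iota.
Qed.

End Extension.

Theorem proposition5p12 (R : realType) :
  (* (i) *)
  [/\ forall (f : {posnum R} -> R) (mu : real_radon R),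
        Binf0 f -> represents mu f ->
        forall xi : {nonneg R}, mik f xi = radon_val mu `[0, xi%:num],
      subring_on *%R 1 (@Binf0 R),
      [set mik f | f in @Binf0 R] `<=` @Mik R
        /\ subring_on (@duhamel R) (cst 1) [set mik f | f in @Binf0 R],
      ring_hom_on (@Binf0 R) *%R 1 (@duhamel R) (cst 1) (@mik R)
    & injective_on (@Binf0 R) (@mik R)] /\
  (* (ii) *)
  (exists iota : {posnum R} -> R,
    [/\ Binf0 iota,
        mik iota = (fun xi : {nonneg R} => xi%:num),
        (forall iota' : {posnum R} -> R, Binf0 iota' ->
           mik iota' = (fun xi : {nonneg R} => xi%:num) -> iota' = iota)
      & forall z : {posnum R}, iota z = 1 / z%:num]) /\
  (* (iii) *)
  (forall (K : fieldType) (j : ({nonneg R} -> R) -> K),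
    Mik_fraction_field j ->
    exists phi : ({posnum R} -> R) -> K,
      [/\ ring_hom_on (@Binf R) *%R 1 *%R 1 phi,
          (forall (a : R) (f : {posnum R} -> R),
             Binf f -> phi (a *: f) = j (cst a) * phi f),
          (forall f : {posnum R} -> R, Binf0 f -> phi f = j (mik f)),
          injective_on (@Binf R) phi
        & forall psi : ({posnum R} -> R) -> K,
            ring_hom_on (@Binf R) *%R 1 *%R 1 psi ->
            (forall f : {posnum R} -> R, Binf0 f -> psi f = j (mik f)) ->
            forall f : {posnum R} -> R, Binf f -> psi f = phi f]).
Proof.
split.
  split.
  - by move=> f mu _ muf xi; rewrite (mikE muf).
  - split; first exact: Binf0_cst.
      by move=> f g f0 g0; apply: Binf0D => //; exact: Binf0N.
    by move=> f g; exact: Binf0M.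
  - split; first by move=> _ [f f0 <-]; exact: mik_Mik.
    split.
    + by exists (cst 1); [exact: Binf0_cst|exact: mik_cst].
    + move=> _ _ [f f0 <-] [g g0 <-]; exists (f - g).
        by apply: Binf0D => //; exact: Binf0N.
      apply/eqP; rewrite eq_sym subr_eq -mikD ?subrK//.
      by apply: Binf0D => //; exact: Binf0N.
    + move=> _ _ [f f0 <-] [g g0 <-]; exists (f * g); first exact: Binf0M.
      exact: mikM.
  - split; first exact: mik_cst.
      by move=> f g; exact: mikD.
    by move=> f g; exact: mikM.
  - by move=> f g /Binf0_Binf f0 /Binf0_Binf g0; exact: mik_inj.
split.
  exists iota_fun; split.
  - exact: Binf0_iota.
  - exact: mik_iota.
  - move=> iota' i0 mi; apply: (mik_inj (Binf0_Binf i0)).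
      exact: Binf0_Binf Binf0_iota.
    by rewrite mi mik_iota.
  - by move=> z; rewrite div1r.
move=> K j jfrac; exists (mik_extension j); split.
- exact: mik_extension_hom.
- exact: mik_extensionZ.
- exact: mik_extensionE.
- exact: mik_extension_inj.
- exact: mik_extension_unique.
Qed.
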